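(* Let $X$ be a homogeneous Quasi-Skipfree (QSF) process as described in the context, and assume that $D=c\cdot r$, where $c=(c_0,\ldots,c_\ell)^T$ is a column vector and $r$ is a row vector. Let $\hat t=(r\cdot t_0,\ldots,r\cdot t_\ell)$, where $t_i$ is the $i$-th column of $T$, and let $\gamma=\hat t\cdot c=\sum_{i=0}^{\ell}c_i\,\hat t_i$ with $\hat t_i=r\cdot t_i$. (1) If $\gamma<1$ and $\ell<\infty$, then the Markov process $X$ is positive recurrent. (2) If the Markov process $X$ is positive recurrent, then $\gamma<1$. (3) In either case, the stationary distribution $\pi$ of $X$ satisfies $$\pi_{(m,j)}=\gamma^{-(m+1)}\sum_{i=0}^{\ell}\pi_{(0,i)}\,c_i\,\hat t_j\qquad\text{for all } m\le -1,\ j\in\{0,\ldots,\ell\}.$$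
   Context: Homogeneous QSF process: a continuous-time Markov process $X$ on $S=\{(m,i): m\in\mathbb Z,\ m\le 0,\ i\in\{0,\ldots,\ell\}\}$ (with $\ell\ge 0$, where $\ell=\infty$ is allowed unless excluded); $m$ is the level and $i$ the phase, and $L_m=\{(m,i): 0\le i\le \ell\}$. Its $q$-matrix $Q=(q_{(k,i)(l,j)})$ is given by $(\ell+1)\times(\ell+1)$ matrices $D=(d_{ij})$, $W=(w_{ij})$, $U^s=(u^s_{ij})$ ($s\ge1$) and boundary matrices $W'$, $U^{n'}$ ($n\ge 1$): $q_{(m,i)(m-1,j)}=d_{ij}$ for $m\le 0$; $q_{(m,i)(m,j)}=w_{ij}$ for $m\le -1$; $q_{(m,i)(m+s,j)}=u^s_{ij}$ for $s\ge 1$, $m+s\le -1$; $q_{(m,i)(0,j)}=u^{n'}_{ij}$ for $m=-n\le -1$; $q_{(0,i)(0,j)}=w'_{ij}$; all other entries are $0$. The boundary matrices are such that all row sums of $Q$ are zero (for example $U^{n'}=\sum_{s\ge n}U^s$, $W'=W+\sum_{s\ge1}U^s$). Throughout, $Q$ is irreducible, conservative, stable and non-explosive (rates may be unbounded as a function of the state), and $X$ is the minimal process. The matrix $T$: for $m\le 0$ and $(k,i),(l,j)$ in levels $\le m-1$, let ${}_m\tau_{(k,i)(l,j)}$ be the expected amount of time spent in state $(l,j)$ before the process enters a level $\ge m$, given that it starts in $(k,i)$. $T$ is the $(\ell+1)\times(\ell+1)$ matrix $T_{ij}={}_m\tau_{(m-1,i)(m-1,j)}$; by homogeneity it does not depend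 on $m$. *)

(* Defs.v *)
From HB Require Import structures.
From mathcomp Require Import all_boot all_order all_algebra.
From mathcomp Require Import all_classical all_reals all_analysis.

Set Implicit Arguments.
Unset Strict Implicit.
Unset Printing Implicit Defensive.

Import Order.TTheory GRing.Theory Num.Theory.
Import numFieldNormedType.Exports.

Local Open Scope classical_set_scope.
Local Open Scope ring_scope.

Section QMatrix.
Context {R : realType} {S : countType}.
Implicit Type Q : S -> S -> R.

(* Stability, i.e. finiteness of the diagonal, is built into the type of Q. *)
Definition stable_conservative Q : Prop :=
  (forall x y, x != y -> 0 <= Q x y) /\
  (forall x, (\esum_(y in [set y | y != x]) (Q x y)%:E)%E = (- Q x x)%:E).

Definition irreducible Q : Prop :=
  forall x y, exists p : seq S,
    path (fun a b => (a != b) && (0 < Q a b)) x p /\ last x p = y.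

Definition exit_rate Q (x : S) : R := - Q x x.

(* Meaningful when x is not absorbing; this is automatic for an irreducible Q
   on at least two states. *)
Definition jump_prob Q (x y : S) : R :=
  if x == y then 0 else Q x y / exit_rate Q x.

End QMatrix.

(* A pure jump process is given by its successive states Y 0, Y 1, ... and
   holding times H 0, H 1, ..., on a space carrying one probability P x for each
   initial state x. *)
Section JumpProcess.
Context {R : realType} {S : countType} {d : measure_display}
  {Omega : measurableType d}.
Variables (P : S -> probability Omega R).
Variables (Y : nat -> Omega -> S) (H : nat -> Omega -> R).

(* Under P x, the sequence Y is a Markov chain started at x with transition
   matrix [jump_prob Q] and, given Y, the holding times are independent, H k
   being exponential of parameter [exit_rate Q (Y k)]. *)
Definition minimal_process (Q : S -> S -> R) : Prop :=
  [/\ forall n y, measurable [set w | Y n w = y],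
      forall n, measurable_fun setT (H n),
      forall n w, 0 < H n w
    & forall (x : S) (n : nat) (y : nat -> S) (s : nat -> R),
        (forall k, 0 <= s k) ->
        P x [set w | (forall k, (k <= n)%N -> Y k w = y k) /\
                     (forall k, (k < n)%N -> s k < H k w)] =
        ((y 0%N == x)%:R *
         \prod_(k < n) (expR (- (exit_rate Q (y k) * s k)) *
                        jump_prob Q (y k) (y k.+1)))%:E].

Definition jump_time (n : nat) (w : Omega) : R := \sum_(k < n) H k w.

Definition nonexplosive : Prop :=
  forall x, {ae P x, forall w, jump_time n w @[n --> \oo] --> +oo}.

(* The state at time t; None after an explosion. *)
Definition state_at (t : R) (w : Omega) : option S :=
  xget None [set Some (Y n w) |
              n in [set n | jump_time n w <= t < jump_time n.+1 w]].

(* First time, not before t0, at which the process is in A; +oo if none. *)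
Definition first_time (t0 : R) (A : set S) (w : Omega) : \bar R :=
  ereal_inf [set t%:E | t in [set t | t0 <= t /\
                                exists2 y, A y & state_at t w = Some y]].

Definition expected_time_before (A : set S) (x y : S) : \bar R :=
  (\int[P x]_w (@lebesgue_measure R)
     [set t : R | [/\ (0 <= t)%R, t%:E < first_time 0 A w &
                     state_at t w = Some y]])%E.

(* Finite mean return times, a return being a visit after the first jump. *)
Definition positive_recurrent : Prop :=
  forall x, (\int[P x]_w first_time (jump_time 1 w) [set x] w < +oo)%E.

Definition transition_prob (t : R) (x y : S) : \bar R :=
  P x [set w | state_at t w = Some y].

Definition stationary_distribution (p : S -> R) : Prop :=
  [/\ forall x, 0 <= p x,
      (\esum_(x in [set: S]) (p x)%:E = 1)%E
    & forall (t : R) (y : S), 0 <= t ->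
        (\esum_(x in [set: S]) ((p x)%:E * transition_prob t x y) = (p y)%:E)%E].

End JumpProcess.

(* Phases 0, ..., l, with None standing for l = infinity. *)
Definition is_phase (l : option nat) (i : nat) : bool :=
  if l is Some L then (i <= L)%N else true.

Definition phase (l : option nat) : Type := {i : nat | is_phase l i}.

(* (n, i) stands for the state at level m = - n in phase i. *)
Definition state (l : option nat) : Type := (nat * phase l)%type.

Section QSF.
Context {R : realType} {l : option nat}.

(* U s is used for s >= 1 only and U' n, the rates from level - n into level 0,
   for n >= 1 only. *)
Definition qsf_matrix (D W : phase l -> phase l -> R)
    (U : nat -> phase l -> phase l -> R)
    (W' : phase l -> phase l -> R) (U' : nat -> phase l -> phase l -> R) (x y : state l) : R :=
  let: (n, i) := x in
  let: (k, j) := y in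
  if k == n.+1 then D i j
  else if k == n then (if n == 0%N then W' i j else W i j)
  else if k == 0%N then U' n i j
  else if (k < n)%N then U (n - k)%N i j
  else 0.

(* A limit of partial sums rather than [esum], which is meant for nonnegative
   terms: the entries of c and r may be negative. *)
Definition phase_sum (F : phase l -> \bar R) : \bar R :=
  (\sum_(0 <= k <oo) oapp F 0 (insub k : option (phase l)))%E.

Context {d : measure_display} {Omega : measurableType d}.
Variables (P : state l -> probability Omega R).
Variables (Y : nat -> Omega -> state l) (H : nat -> Omega -> R).

(* The matrix T computed at level m = - n: levels >= m are depths <= n, and
   level m - 1 is depth n.+1. *)
Definition T_matrix (n : nat) (i j : phase l) : \bar R :=
  expected_time_before P Y H [set y | (y.1 <= n)%N] (n.+1, i) (n.+1, j).

Definition t_hat (T : phase l -> phase l -> \bar R) (r : phase l -> R)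
    (j : phase l) : \bar R :=
  phase_sum (fun k => ((r k)%:E * T k j)%E).

Definition gamma_of (T : phase l -> phase l -> \bar R) (c r : phase l -> R) :
    \bar R :=
  phase_sum (fun i => ((c i)%:E * t_hat T r i)%E).

End QSF.

(* Main.v *)
Require Import Defs.
From HB Require Import structures.
From mathcomp Require Import all_boot all_order all_algebra.
From mathcomp Require Import all_classical all_reals all_analysis.
From mathcomp Require Import measurable_realfun.
From mathcomp Require Import ring lra.

Set Implicit Arguments.
Unset Strict Implicit.
Unset Printing Implicit Defensive.

Import Order.TTheory GRing.Theory Num.Theory.
Import numFieldNormedType.Exports.

Local Open Scope classical_set_scope.
Local Open Scope ring_scope.

(** For a kernel [k], [green k m] is the least nonnegative solution [g] of
    [g = m + g k].  Let [A_n] be the set of the states of level at most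
    [- (n + 1)].  The process enters [A_n] only by a jump from level [- n] into
    level [- (n + 1)], and [D = c r] makes the entrance phase distribution
    proportional to [r], whatever the phase left.  Hence a measure [pi] whose
    mass inside each [A_n] is the occupation produced by these entrances
    satisfies
      [pi (n + 1, j) = (\sum_i pi (n, i) c_i) that_j],
    and, multiplying by [c_j] and summing over [j],
      [pi (n + 1, j) = (\sum_i pi (0, i) c_i) gamma ^ n that_j].
    Two measures are of this kind.
    - The mean occupation during an excursion from a state [x0] of level 0,
      because of the minimality of [green].  Its mass is the mean return time to
      [x0], so positive recurrence forces [gamma < 1].  Conversely, if
      [gamma < 1] and there are finitely many phases, its mass is finite; being
      excessive, it dominates a multiple of the occupation measure of the
      excursions from any other state, and non-explosion turns the mass of the
      latter into a mean return time.
    - Any stationary distribution [p].  The Laplace transform of [p P_t = p]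
      gives a balance equation for the process killed at rate [lam]; as [lam]
      tends to 0 the contribution of the starting points in [A_n] vanishes,
      since the Green function of [A_n] is bounded in its first argument.

    The finite-dimensional laws defining the process determine the Laplace
    transforms and the mean occupation times by Fubini. *)

(** * Sums of nonnegative extended reals *)

Section ESum.
Context {R : realType}.
Local Open Scope ereal_scope.

Lemma esum_ge1 (S : choiceType) (f : S -> \bar R) x :
  (forall y, 0 <= f y) -> f x <= \esum_(y in [set: S]) f y.
Proof.
move=> f0; apply: esum_ge; exists [set x]; first by split.
by rewrite fsbig_set1.
Qed.

(** The inequality [le] comes from finite subsums and holds for every nonnegative factor. For a
    positive real [a] the converse is [le] applied to the inverse of [a]; the values 0 and [+oo] are
    treated apart. *)
Lemma esumZl (S : choiceType) (f : S -> \bar R) a :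
  0 <= a -> (forall y, 0 <= f y) ->
  \esum_(y in [set: S]) (a * f y) = a * \esum_(y in [set: S]) f y.
Proof.
move=> a0 f0.
have le (b : \bar R) (g : S -> \bar R) : 0 <= b -> (forall y, 0 <= g y) ->
    \esum_(y in [set: S]) (b * g y) <= b * \esum_(y in [set: S]) g y.
  move=> b0 g0; apply: ge_ereal_sup => _ [X [finX _] <-].
  rewrite -ge0_mule_fsumr//; apply: lee_wpmul2l => //.
  by apply: esum_ge; exists X.
apply/eqP; rewrite eq_le le//=.
case: a a0 => [r r0| _ |//].
- rewrite lee_fin in r0; have [->|rn0] := eqVneq r 0%R.
    by rewrite mul0e esum_ge0// => y _; rewrite mul0e.
  have {}r0 : (0 < r)%R by rewrite lt_def rn0.
  rewrite -lee_pdivlMl//.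
  apply: le_trans (le _ _ _ _); last 2 first.
  + by rewrite lee_fin invr_ge0 ltW.
  + by move=> y; rewrite mule_ge0// lee_fin ltW.
  apply: le_esum => y _.
  by rewrite muleA -EFinM mulVf ?gt_eqF// mul1e.
- have [fx|] := pselect (exists x, f x != 0); last first.
    move=> /forallNP nf.
    rewrite (_ : esum _ _ = 0) ?mule0 ?esum_ge0// => [y _|].
      by rewrite mule_ge0.
    by apply: esum1 => y _; apply/eqP/negPn/negP/nf.
  case: fx => x fx; apply: le_trans (esum_ge1 x _).
    by rewrite [leRHS]gt0_mulye ?leey// lt_def fx f0.
  by move=> y; rewrite mule_ge0.
Qed.

Lemma esumZr (S : choiceType) (f : S -> \bar R) a :
  0 <= a -> (forall y, 0 <= f y) ->
  \esum_(y in [set: S]) (f y * a) = (\esum_(y in [set: S]) f y) * a.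
Proof.
by move=> a0 f0; rewrite muleC -esumZl//; apply: eq_esum => y _; rewrite muleC.
Qed.

Lemma exchange_esum (S T : choiceType) (f : S -> T -> \bar R) :
  (forall x y, 0 <= f x y) ->
  \esum_(x in [set: S]) \esum_(y in [set: T]) f x y =
  \esum_(y in [set: T]) \esum_(x in [set: S]) f x y.
Proof.
move=> f0; rewrite (esum_esum (J := fun=> setT))// (esum_esum (J := fun=> setT))//.
rewrite (reindex_esum ([set: T] `*`` (fun=> [set: S])) _ (fun x => (x.2, x.1)))//.
split=> //= [[a b] [a' b'] _ _ [-> ->]//|[a b] _].
by exists (b, a).
Qed.

Lemma esum_nneseries (S : choiceType) (f : nat -> S -> \bar R) :
  (forall n x, 0 <= f n x) ->
  \esum_(x in [set: S]) \sum_(n <oo) f n x =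
  \sum_(n <oo) \esum_(x in [set: S]) f n x.
Proof.
move=> f0; rewrite nneseries_esumT; last by move=> n; exact: esum_ge0.
rewrite exchange_esum//; apply: eq_esum => x _.
by rewrite nneseries_esumT.
Qed.

Lemma nneseries_le (f : nat -> \bar R) x : (forall n, 0 <= f n) ->
  (forall N, \sum_(0 <= n < N) f n <= x) -> \sum_(n <oo) f n <= x.
Proof.
by move=> f0 h; apply: lime_le; [exact: is_cvg_nneseries | exact: nearW].
Qed.

Lemma nneseries_ge1 (f : nat -> \bar R) n : (forall n, 0 <= f n) ->
  f n <= \sum_(n <oo) f n.
Proof. by move=> f0; rewrite nneseries_esumT//; exact: esum_ge1. Qed.

Lemma nneseries_recl1 (f : nat -> \bar R) : (forall n, 0 <= f n) ->
  \sum_(n <oo) f n = f 0%N + \sum_(n <oo) f n.+1.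
Proof.
move=> f0; rewrite nneseries_recl// -nneseries_addn//; congr (_ + _).
by apply: eq_eseriesr => n _; rewrite addn1.
Qed.

Lemma nneseriesZl_ge0 (f : nat -> \bar R) x : 0 <= x -> (forall n, 0 <= f n) ->
  \sum_(n <oo) (x * f n) = x * \sum_(n <oo) f n.
Proof.
by move=> x0 f0; rewrite !nneseries_esumT ?esumZl// => n; rewrite mule_ge0.
Qed.

Lemma esum_dirac (S : choiceType) (f : S -> \bar R) x : 0 <= f x ->
  \esum_(y in [set: S]) (if y == x then f y else 0) = f x.
Proof.
move=> f0; rewrite -(esum_set1 f0) [RHS]esum_mkcond; apply: eq_esum => y _.
by congr (if _ then _ else _); apply/eqP/idP => [->|]; rewrite inE.
Qed.

Lemma esumZl_lty (S : choiceType) (f : S -> \bar R) a :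
  0 < a -> (forall x, 0 <= f x) ->
  \esum_(x in [set: S]) (a * f x) < +oo -> \esum_(x in [set: S]) f x < +oo.
Proof.
move=> a0 f0; rewrite esumZl// ?(ltW a0)//.
have : 0 <= \esum_(x in [set: S]) f x by exact: esum_ge0.
case: (\esum_(x in [set: S]) f x) => [s| |]//; first by rewrite ltry.
by rewrite gt0_muley.
Qed.

(** By comparison with the series of the constant [a], whose sum satisfies [s = a + s]; no finite
    [s] does, since [a > 0]. *)
Lemma nneseries_cst_pinfty (f : nat -> \bar R) a :
  (forall n, 0 <= f n) -> 0 < a -> (forall n, a <= f n) ->
  \sum_(n <oo) f n = +oo.
Proof.
move=> f0 a0 af; apply/eqP; rewrite -leye_eq.
apply: le_trans (lee_nneseries (u := fun=> a) _ _) => //; last by move=> *; exact: ltW.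
rewrite leye_eq; apply/negPn/negP => sy.
set s := (\sum_(n <oo) a) in sy.
have s0 : 0 <= s by apply: nneseries_ge0 => *; exact: ltW.
have : s = a + s by rewrite {1}/s nneseries_recl1// => *; exact: ltW.
move: s s0 sy => s s0 sy; case: a a0 {af} => [a| |]//; last by case: s s0 sy.
by case: s s0 sy => [s| |]//; rewrite -EFinD lte_fin => _ _ a0 [E]; lra.
Qed.

End ESum.

(** * Green functions of nonnegative kernels *)

Section Kernels.
Context {R : realType} {S : choiceType}.
Implicit Types (k : S -> S -> \bar R) (m : S -> \bar R) (A : set S).
Local Open Scope ereal_scope.

(** Measures are row vectors: [step k m] is the product [m k], and [green k m] is the Neumann series
    [m + m k + m k^2 + ...]. *)
Definition step k m (y : S) : \bar R := \esum_(x in [set: S]) (m x * k x y).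

Definition green k m (y : S) : \bar R := \sum_(n <oo) iter n (step k) m y.

(** Only the target is restricted. A source outside [A] can still enter [A], so this kernel also
    describes the flow into [A] of a mass placed outside. *)
Definition krestr A k (x y : S) : \bar R := if y \in A then k x y else 0.

Definition mrestr A m (x : S) : \bar R := if x \in A then m x else 0.

Definition mdirac (x y : S) : \bar R := if y == x then 1 else 0.

Variables (k : S -> S -> \bar R).
Hypothesis k0 : forall x y, 0 <= k x y.

Lemma step_ge0 m y : (forall x, 0 <= m x) -> 0 <= step k m y.
Proof. by move=> m0; apply: esum_ge0 => x _; rewrite mule_ge0. Qed.

Lemma iter_step_ge0 m n y : (forall x, 0 <= m x) -> 0 <= iter n (step k) m y.
Proof. by move=> m0; elim: n y => [|n IH] y //=; exact: step_ge0. Qed.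

Lemma green_ge0 m y : (forall x, 0 <= m x) -> 0 <= green k m y.
Proof. by move=> m0; apply: nneseries_ge0 => n _ _; exact: iter_step_ge0. Qed.

Lemma le_step m m' y : (forall x, m x <= m' x) -> step k m y <= step k m' y.
Proof. by move=> h; apply: le_esum => x _; exact: lee_wpmul2r. Qed.

Lemma stepD m m' y : (forall x, 0 <= m x) -> (forall x, 0 <= m' x) ->
  step k (fun x => m x + m' x) y = step k m y + step k m' y.
Proof.
move=> m0 m'0; rewrite /step -esumD => [|x _|x _]; try by rewrite mule_ge0.
by apply: eq_esum => x _; rewrite ge0_muleDl.
Qed.

Lemma step_sum (m : nat -> S -> \bar R) N y : (forall n x, 0 <= m n x) ->
  step k (fun x => \sum_(0 <= n < N) m n x) y = \sum_(0 <= n < N) step k (m n) y.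
Proof.
move=> m0; rewrite /step -esum_sum; last by move=> *; rewrite mule_ge0.
by apply: eq_esum => x _; rewrite ge0_sume_distrl.
Qed.

Lemma greenE m y : (forall x, 0 <= m x) ->
  green k m y = m y + step k (green k m) y.
Proof.
move=> m0; rewrite {1}/green nneseries_recl1; last by move=> n; exact: iter_step_ge0.
congr (_ + _); rewrite /step /green /= -esum_nneseries; last first.
  by move=> n x; rewrite mule_ge0// iter_step_ge0.
apply: eq_esum => x _; rewrite !nneseries_esumT.
- by rewrite esumZr// => n; exact: iter_step_ge0.
- by move=> n; exact: iter_step_ge0.
- by move=> n; rewrite mule_ge0// iter_step_ge0.
Qed.

(** The partial sums of the series satisfy [s_(N+1) = m + s_N k], so by induction they all stay
    below [mu]. *)
Lemma green_min m mu : (forall x, 0 <= m x) -> (forall x, 0 <= mu x) ->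
  (forall y, m y + step k mu y <= mu y) -> forall y, green k m y <= mu y.
Proof.
move=> m0 mu0 h y; apply: nneseries_le => [n|N]; first exact: iter_step_ge0.
elim: N y => [|N IH] y; first by rewrite big_geq.
rewrite big_nat_recl//=; apply: le_trans (h y); apply: leeD => //.
rewrite -step_sum; last by move=> *; exact: iter_step_ge0.
exact: le_step.
Qed.

Lemma le_green m m' y : (forall x, 0 <= m x) -> (forall x, m x <= m' x) ->
  green k m y <= green k m' y.
Proof.
move=> m0 h.
have m'0 x : 0 <= m' x by apply: le_trans (h x).
apply: green_min => // [x|x]; first exact: green_ge0.
by rewrite (greenE x m'0); apply: leeD.
Qed.

Lemma iter_step_dirac m n y : (forall x, 0 <= m x) ->
  iter n (step k) m y =
  \esum_(x in [set: S]) (m x * iter n (step k) (mdirac x) y).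
Proof.
move=> m0.
have d0 x z : 0 <= (mdirac x z : \bar R) by rewrite /mdirac; case: ifP.
elim: n y => [|n IH] y /=.
  rewrite -[LHS](esum_dirac (m0 y)); apply: eq_esum => x _.
  by rewrite /mdirac eq_sym; case: eqP => _; rewrite ?mule1 ?mule0.
rewrite /step; under eq_esum do rewrite IH.
have ki x z : 0 <= iter n (step k) (mdirac x) z by exact: iter_step_ge0.
transitivity (\esum_(x in [set: S]) \esum_(z in [set: S])
    (m z * iter n (step k) (mdirac z) x * k x y)).
  by apply: eq_esum => x _; rewrite esumZr// => z; rewrite mule_ge0.
rewrite exchange_esum; last by move=> *; rewrite !mule_ge0.
apply: eq_esum => x _; rewrite -esumZl//; last by move=> *; rewrite mule_ge0.
by apply: eq_esum => z _; rewrite muleA.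
Qed.

(** Superposition over the starting point. For a substochastic [k], [green k (mdirac x) y] is the
    mean number of visits to [y] from [x]. *)
Lemma green_dirac m y : (forall x, 0 <= m x) ->
  green k m y = \esum_(x in [set: S]) (m x * green k (mdirac x) y).
Proof.
move=> m0.
have d0 x z : 0 <= (mdirac x z : \bar R) by rewrite /mdirac; case: ifP.
rewrite /green; under eq_eseriesr do rewrite iter_step_dirac//.
rewrite -esum_nneseries; last by move=> *; rewrite mule_ge0// iter_step_ge0.
apply: eq_esum => x _; rewrite nneseriesZl_ge0// => n; exact: iter_step_ge0.
Qed.

Lemma greenD m m' y : (forall x, 0 <= m x) -> (forall x, 0 <= m' x) ->
  green k (fun x => m x + m' x) y = green k m y + green k m' y.
Proof.
move=> m0 m'0.
have d0 x z : 0 <= (mdirac x z : \bar R) by rewrite /mdirac; case: ifP.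
have g0 x z : 0 <= green k (mdirac x) z by exact: green_ge0.
rewrite !green_dirac// -?esumD//; try by move=> *; rewrite ?mule_ge0 ?adde_ge0.
  by apply: eq_esum => x _; rewrite ge0_muleDl.
Qed.

Lemma krestr_ge0 A x y : 0 <= krestr A k x y.
Proof. by rewrite /krestr; case: ifP. Qed.

Lemma mrestr_ge0 A m x : (forall x, 0 <= m x) -> 0 <= mrestr A m x.
Proof. by rewrite /mrestr; case: ifP. Qed.

Lemma mrestrT A m x : x \in A -> mrestr A m x = m x.
Proof. by rewrite /mrestr => ->. Qed.

Lemma mdirac_ge0 x y : 0 <= (mdirac x y : \bar R).
Proof. by rewrite /mdirac; case: ifP. Qed.

Lemma mrestrDC A m : (fun x => mrestr (~` A) m x + mrestr A m x) = m.
Proof.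
apply/funext => x; rewrite /mrestr in_setC.
by case: (x \in A); rewrite /= (adde0, add0e).
Qed.

Lemma step_krestr_in A m y : y \in A -> step (krestr A k) m y = step k m y.
Proof. by move=> yA; apply: eq_esum => x _; rewrite /krestr yA. Qed.

Lemma step_krestr_out A m y : y \notin A -> step (krestr A k) m y = 0.
Proof.
by move=> yA; apply: esum1 => x _; rewrite /krestr (negbTE yA) mule0.
Qed.

End Kernels.

Section Decomposition.
Context {R : realType} {S : choiceType}.
Variables (k : S -> S -> \bar R).
Hypothesis k0 : forall x y, (0 <= k x y)%E.
Implicit Types (m : S -> \bar R) (A : set S).
Local Open Scope ereal_scope.

(* Last-entrance decomposition: both inequalities come from minimality of
   [green]. *)
Lemma green_krestr_sub A B nu y :
  A `<=` B -> (forall x, 0 <= nu x) -> y \in A ->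
  let mu := green (krestr B k) nu in
  mu y = green (krestr A k) (fun x => mrestr A nu x +
           step (krestr A k) (mrestr (~` A) mu) x) y.
Proof.
move=> AB nu0 yA mu.
set kA := krestr A k; set kB := krestr B k.
have kA0 x z : 0 <= kA x z by exact: krestr_ge0.
have kB0 x z : 0 <= kB x z by exact: krestr_ge0.
have mu0 x : 0 <= mu x by exact: green_ge0.
set src := fun x => _ + _.
have src0 x : 0 <= src x.
  by rewrite adde_ge0 ?mrestr_ge0// step_ge0// => ?; rewrite mrestr_ge0.
have srcN x : x \notin A -> src x = 0.
  by move=> xA; rewrite /src step_krestr_out// /mrestr (negbTE xA) adde0.
pose g := green kA src.
have g0 x : 0 <= g x by exact: green_ge0.
have gN x : x \notin A -> g x = 0.
  by move=> xA; rewrite /g greenE// srcN// step_krestr_out// adde0.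
have stepAB m x : x \in A -> step kB m x = step kA m x.
  by move=> xA; rewrite !step_krestr_in//; move: xA; rewrite !inE; exact: AB.
have muE x : mu x = nu x + step kB mu x by rewrite /mu -greenE.
(* The restriction of [mu] to [A] solves the equation of which [g] is the least solution. *)
have gmu x : g x <= mrestr A mu x.
  apply: green_min => // [z|z]; first exact: mrestr_ge0.
  case: (boolP (z \in A)) => zA; last first.
    by rewrite srcN// step_krestr_out// /mrestr (negbTE zA) adde0.
  rewrite /src !mrestrT// -addeA -stepD//; try by move=> *; exact: mrestr_ge0.
  by rewrite mrestrDC [leRHS]muE stepAB.
apply/eqP; rewrite eq_le; apply/andP; split; last first.
  by apply: le_trans (gmu y) _; rewrite /mrestr yA.
(* For the reverse inequality, glue [mu] outside [A] to [g] inside. The result lies below [mu] and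
   is a supersolution of the equation defining [mu], so minimality bounds [mu] by it. *)
pose mu' x := mrestr (~` A) mu x + g x.
have mu'in x : x \in A -> mu' x = g x.
  by move=> xA; rewrite /mu' /mrestr in_setC xA add0e.
have mu'out x : x \notin A -> mu' x = mu x.
  by move=> xA; rewrite /mu' /mrestr in_setC xA gN// adde0.
have mu'le x : mu' x <= mu x.
  case: (boolP (x \in A)) => xA; last by rewrite mu'out.
  by rewrite mu'in//; apply: le_trans (gmu x) _; rewrite /mrestr xA.
have mu'0 x : 0 <= mu' x by rewrite adde_ge0 ?mrestr_ge0.
rewrite -/(g y) -mu'in//; apply: green_min => // x.
case: (boolP (x \in A)) => xA.
  rewrite mu'in// stepAB// /mu' stepD//; last by move=> ?; exact: mrestr_ge0.
  by rewrite addeA /g [leRHS]greenE// /src mrestrT.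
rewrite mu'out// [leRHS]muE; apply: leeD => //; exact: le_step.
Qed.

Lemma green_sub A nu y : (forall x, 0 <= nu x) -> y \in A ->
  green k nu y = green (krestr A k) (fun x => mrestr A nu x +
           step (krestr A k) (mrestr (~` A) (green k nu)) x) y.
Proof.
move=> nu0 yA; have /= := green_krestr_sub (@subsetT _ A) nu0 yA.
rewrite (_ : krestr setT k = k)//.
by apply/funext => a; apply/funext => b; rewrite /krestr in_setT.
Qed.

Hypothesis k1 : forall x, \esum_(y in [set: S]) k x y <= 1.

Lemma esum_iter_step_le1 n x :
  \esum_(y in [set: S]) iter n (step k) (mdirac x) y <= 1.
Proof.
have nu0 i y : 0 <= iter i (step k) (mdirac x) y.
  by apply: iter_step_ge0 => // ?; exact: mdirac_ge0.
elim: n => [|n IH] /=; first by rewrite (esum_dirac (f := fun=> 1)).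
apply: le_trans IH; rewrite /step exchange_esum; last by move=> *; rewrite mule_ge0.
apply: le_esum => y _; rewrite esumZl// -[leRHS]mule1.
exact: lee_wpmul2l.
Qed.

(* The left-hand side is the probability of leaving [A] at [z]. *)
Lemma step_green_dirac_le1 A x z : z \notin A ->
  step k (green (krestr A k) (mdirac x)) z <= 1.
Proof.
move=> zA; set kA := krestr A k.
have kA0 a b : 0 <= kA a b by exact: krestr_ge0.
have nu0 n y : 0 <= iter n (step kA) (mdirac x) y.
  by apply: iter_step_ge0 => // ?; exact: mdirac_ge0.
have -> : step k (green kA (mdirac x)) z =
    \sum_(n <oo) step k (iter n (step kA) (mdirac x)) z.
  rewrite /step -esum_nneseries; last by move=> *; rewrite mule_ge0.
  apply: eq_esum => y _; rewrite muleC -nneseriesZl_ge0//.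
  by apply: eq_eseriesr => n _; rewrite muleC.
apply: nneseries_le => [n|N]; first exact: step_ge0.
(* Invariant of the induction: the mass that has exited at [z] during the first [N] steps, plus the
   mass still present after them, is at most 1. *)
suff : \sum_(0 <= n < N) step k (iter n (step kA) (mdirac x)) z +
    \esum_(y in [set: S]) iter N (step kA) (mdirac x) y <= 1.
  by apply: le_trans; rewrite leeDl// esum_ge0.
elim: N => [|N]; first by rewrite big_geq// add0e /= (esum_dirac (f := fun=> 1)).
apply: le_trans; rewrite big_nat_recr//= -addeA leeD//.
rewrite {2}/step exchange_esum; last by move=> *; rewrite mule_ge0.
rewrite /step -esumD; last 2 first.
- by move=> *; rewrite mule_ge0.
- by move=> *; rewrite esum_ge0// => *; rewrite mule_ge0.
apply: le_esum => y _; rewrite esumZl// -ge0_muleDr// ?esum_ge0//.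
rewrite -[leRHS]mule1; apply: lee_wpmul2l => //.
apply: le_trans (k1 y); rewrite -[k y z](esum_dirac (f := k y))//.
rewrite -esumD//; last by move=> *; case: ifP.
apply: le_esum => w _; rewrite /kA /krestr.
have [->|_] := eqVneq w z; first by rewrite (negbTE zA) adde0.
by rewrite add0e; case: ifP.
Qed.

(* Along a path from [y] out of [A], [green y * k y z] is at most [green z] as long
   as [z] is in [A], and at most 1 at the exit. *)
Lemma green_dirac_bounded A y p :
  path (fun a b => 0 < k a b) y p -> last y p \notin A -> y \in A ->
  exists C : R, forall x, green (krestr A k) (mdirac x) y <= C%:E.
Proof.
set kA := krestr A k.
have kA0 a b : 0 <= kA a b by exact: krestr_ge0.
have g0 x w : 0 <= green kA (mdirac x) w.
  by apply: green_ge0 => // ?; exact: mdirac_ge0.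
elim: p y => [|z p IH] y /=; first by move=> _ /negbTE ->.
move=> /andP[kyz pz] lA yA.
suff [C hC] : exists C : R, forall x, green kA (mdirac x) y * k y z <= C%:E.
  have : k y z <= 1 by apply: le_trans (k1 y); exact: esum_ge1.
  case: (k y z) kyz hC => [r r0 hC _|_ _ //|//].
  exists (C / r)%R => x; rewrite EFinM lee_pdivlMr//; exact: hC.
have [zA|zA] := boolP (z \in A).
  have [C hC] := IH _ pz lA zA; exists C => x; apply: le_trans (hC x).
  rewrite [leRHS]greenE//; last exact: mdirac_ge0.
  apply: le_trans (leeDr _ (mdirac_ge0 _ _)); rewrite step_krestr_in//.
  by apply: (esum_ge1 y) => w; rewrite mule_ge0.
exists 1%R => x; apply: le_trans (step_green_dirac_le1 x zA).
by apply: (esum_ge1 y) => w; rewrite mule_ge0.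
Qed.

End Decomposition.

Section KernelComparison.
Context {R : realType} {S : choiceType}.
Implicit Types (k : S -> S -> \bar R) (m : S -> \bar R).
Local Open Scope ereal_scope.

Lemma stepZ k m a y : (forall x y, 0 <= k x y) -> (forall x, 0 <= m x) -> 0 <= a ->
  step k (fun x => a * m x) y = a * step k m y.
Proof.
move=> k0 m0 a0; rewrite /step -esumZl//; last by move=> x; rewrite mule_ge0.
by apply: eq_esum => x _; rewrite muleA.
Qed.

Lemma greenZ k m a y : (forall x y, 0 <= k x y) -> (forall x, 0 <= m x) -> 0 <= a ->
  green k (fun x => a * m x) y = a * green k m y.
Proof.
move=> k0 m0 a0; rewrite (green_dirac k0)//; last by move=> x; rewrite mule_ge0.
have g0 x : 0 <= green k (mdirac x) y by apply: green_ge0 => // ?; exact: mdirac_ge0.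
rewrite (green_dirac k0)// -esumZl//; last by move=> x; rewrite mule_ge0.
by apply: eq_esum => x _; rewrite muleA.
Qed.

Lemma le_green_kernel k k' m y : (forall x y, 0 <= k x y) ->
  (forall x y, k x y <= k' x y) -> (forall x, 0 <= m x) ->
  green k m y <= green k' m y.
Proof.
move=> k0 kk' m0; have k'0 x z : 0 <= k' x z by apply: le_trans (kk' x z).
apply: green_min => // [x|x]; first exact: green_ge0.
rewrite [leRHS](greenE k'0)//; apply: leeD => //; apply: le_esum => z _.
by apply: lee_wpmul2l => //; exact: green_ge0.
Qed.

Lemma green_dirac_ge1 k x : (forall x y, 0 <= k x y) -> 1 <= green k (mdirac x) x.
Proof.
move=> k0; apply: le_trans (nneseries_ge1 0 _); first by rewrite /= /mdirac eqxx.
by move=> n; apply: iter_step_ge0 => // ?; exact: mdirac_ge0.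
Qed.

End KernelComparison.

(** * Integrals against exponential tails *)

Section Integration.
Context {R : realType}.
Local Open Scope ereal_scope.
Notation leb := (@lebesgue_measure R).

(** Enumerating the index type makes results on series available for sums over a countable type,
    through [pickle], and over phases, through [val] and [insub]. *)
Lemma esum_pcan (S : choiceType) (e : S -> nat) (d : nat -> option S)
    (f : S -> \bar R) :
  pcancel e d -> ocancel d e -> (forall x, 0 <= f x) ->
  \esum_(x in [set: S]) f x = \sum_(n <oo) oapp f 0 (d n).
Proof.
move=> ed de f0; rewrite nneseries_esumT; last by move=> n; case: (d n) => /=.
transitivity (\esum_(n in range e) oapp f 0 (d n)).
  rewrite (reindex_esum [set: S] (range e) e).
    by apply: eq_esum => x _; rewrite ed.
  split=> //=.
  by move=> x y _ _ /(congr1 d); rewrite !ed => -[].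
rewrite esum_mkcond; apply: eq_esum => n _; case: ifPn => // nN.
case E : (d n) => [x|//]; move: nN; rewrite notin_setE/=; case.
by exists x => //; have := de n; rewrite E.
Qed.

Lemma integral_esum d (T : measurableType d) (mu : {measure set T -> \bar R})
    (D : set T) (S : countType) (f : S -> T -> \bar R) : measurable D ->
  (forall x, measurable_fun D (f x)) -> (forall x w, 0 <= f x w) ->
  \int[mu]_(w in D) (\esum_(x in [set: S]) f x w) =
  \esum_(x in [set: S]) \int[mu]_(w in D) f x w.
Proof.
move=> mD mf f0.
under eq_integral do rewrite (esum_pcan (@pickleK_inv S) (@pickle_invK S))//.
rewrite (esum_pcan (@pickleK_inv S) (@pickle_invK S)); last first.
  by move=> x; exact: integral_ge0.
rewrite integral_nneseries//; last first.
- by move=> n w _; case: pickle_inv => /=.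
- by move=> n; case: pickle_inv => [x|] /=; [exact: mf|exact: measurable_cst].
apply: eq_eseriesr => n _; case: pickle_inv => [x|] //=.
exact: integral0.
Qed.

(* [\int_0^h e^(-lam t) dt], that is [(1 - e^(-lam h)) / lam], or [h] when
   [lam = 0]. *)
Definition disc (lam h : R) : R :=
  if lam == 0%R then h else ((1 - expR (- (lam * h))) / lam)%R.

Lemma measurable_expRN (lam : R) D : measurable_fun D (fun t => expR (- (lam * t))%R).
Proof.
apply: measurable_funTS.
apply: measurableT_comp; first exact: measurable_expR.
by apply: measurableT_comp => //; exact: measurable_funM.
Qed.

Lemma integral_disc (lam h : R) : (0 <= lam)%R -> (0 < h)%R ->
  \int[leb]_(t in `[0%R, h[) (expR (- (lam * t)))%:E = (disc lam h)%:E.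
Proof.
move=> lam0 h0; rewrite /disc; have [->|ln0] := eqVneq.
  under eq_integral do rewrite mul0r oppr0 expR0.
  by rewrite integral_cst// mul1e /= lebesgue_measure_itv/= lte_fin h0 sube0.
have {ln0}lam0 : (0 < lam)%R by rewrite lt_def ln0.
rewrite integral_itv_bndo_bndc//; last by apply/measurable_EFinP; exact: measurable_expRN.
have := exponential_prob_itv0c lam h0; rewrite /exponential_prob.
have -> : \int[leb]_(x in `[0%R, h]) (exponential_pdf lam x)%:E =
    lam%:E * \int[leb]_(t in `[0%R, h]) (expR (- (lam * t)))%:E.
  rewrite -ge0_integralZl//.
  - apply: eq_integral => t; rewrite inE/= in_itv/= => /andP[t0 _].
    by rewrite exponential_pdfE// mulNr EFinM.
  - by apply/measurable_EFinP; exact: measurable_expRN.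
  - by rewrite lee_fin ltW.
rewrite mulNr -EFinB => E; rewrite mulrC EFinM -E muleA -EFinM mulVf ?mul1e//.
by rewrite gt_eqF.
Qed.

Lemma expR_disc (lam h : R) : (expR (- (lam * h)) = 1 - lam * disc lam h)%R.
Proof.
rewrite /disc; have [->|l0] := eqVneq; first by rewrite !mul0r oppr0 expR0 addr0.
by rewrite mulrCA divff// mulr1 opprB addrC subrK.
Qed.

Lemma disc_ge0 (lam h : R) : (0 <= lam)%R -> (0 < h)%R -> (0 <= disc lam h)%R.
Proof.
move=> l0 h0; rewrite -lee_fin -integral_disc//.
by apply: integral_ge0 => t _; rewrite lee_fin expR_ge0.
Qed.

Lemma measurable_disc d (T : measurableType d) (h : T -> R) (lam : R) :
  measurable_fun setT h -> measurable_fun setT (fun w => disc lam (h w)).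
Proof.
move=> mh; rewrite /disc; case: eqP => // _; apply: measurable_funM => //.
apply: measurable_funB => //; apply: measurableT_comp; first exact: measurable_expR.
by apply: measurableT_comp => //; exact: measurable_funM.
Qed.

Lemma integral_expRN (q : R) : (0 < q)%R ->
  \int[leb]_(t in `[0%R, +oo[) (expR (- (q * t)))%:E = (q^-1)%:E.
Proof.
move=> q0; have := integral_exponential_pdf q0.
rewrite (_ : (fun x => (exponential_pdf q x)%:E) =
   (fun x => q%:E * (expR (- (q * x)))%:E) \_ `[0%R, +oo[); last first.
  apply/funext => x; rewrite /exponential_pdf !patchE.
  by case: ifP => // _; rewrite mulNr EFinM.
rewrite -integral_mkcond ge0_integralZl//.
- move=> E; rewrite -[RHS]mule1 -E muleA -EFinM mulVf ?mul1e// gt_eqF//.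
- by apply/measurable_EFinP; exact: measurable_expRN.
- by rewrite lee_fin ltW.
Qed.

Lemma disc0 (h : R) : disc 0 h = h.
Proof. by rewrite /disc eqxx. Qed.

Lemma discD (lam a h : R) :
  (disc lam (a + h) = disc lam a + expR (- (lam * a)) * disc lam h)%R.
Proof.
rewrite /disc; case: eqVneq => [->|l0]; first by rewrite mul0r oppr0 expR0 mul1r.
by rewrite mulrDr opprD expRD; field.
Qed.

(** Split [[0, a + h[] at [a]; by [discD] the integral over the first piece cancels. *)
Lemma integral_disc_shift (lam a h : R) : (0 <= lam)%R -> (0 <= a)%R -> (0 < h)%R ->
  \int[leb]_(t in `[a, (a + h)%R[) (expR (- (lam * t)))%:E =
  (expR (- (lam * a)) * disc lam h)%:E.
Proof.
move=> l0 a0 h0; have [->|an0] := eqVneq a 0%R.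
  by rewrite add0r mulr0 oppr0 expR0 mul1r integral_disc.
have {an0}a0 : (0 < a)%R by rewrite lt_def an0.
have := integral_disc l0 (addr_gt0 a0 h0); rewrite discD EFinD.
have aU : `[0%R, (a + h)%R[%classic = `[0%R, a[%classic `|` `[a, (a + h)%R[%classic.
  apply/seteqP; split => t; rewrite /= !in_itv/=.
    by move=> /andP[-> ->]; case: (ltP t a) => _; [left|right].
  case=> /andP[h1 h2]; apply/andP; split => //.
    by apply: (lt_trans h2); rewrite ltrDl.
  exact: le_trans (ltW a0) h1.
rewrite aU ge0_integral_setU//; last 2 first.
- by apply/measurable_EFinP; exact: measurable_expRN.
- apply/disj_setPS => t; rewrite /= !in_itv/= => -[/andP[_ +] /andP[+ _]].
  by move=> h1 h2; have := lt_le_trans h1 h2; rewrite ltxx.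
have cancel (x z : R) I : x%:E + I = x%:E + z%:E -> I = z%:E.
  by case: I => [r| |]//; rewrite -!EFinD => -[/addrI ->].
by rewrite integral_disc// => /cancel.
Qed.

(** Under the law weighted by [g], the lifetime [h] has an exponential tail. Write [disc lam (h w)]
    as an integral over the times [t < h w]; Tonelli then leaves the Laplace transform of that
    tail. *)
Lemma integral_exp_tail d (T : measurableType d) (mu : probability T R)
    (g h : T -> R) (a q lam : R) :
  measurable_fun setT g -> measurable_fun setT h ->
  (forall w, 0 <= g w)%R -> (forall w, 0 < h w)%R -> (0 < q)%R -> (0 <= lam)%R ->
  (forall t, (0 <= t)%R ->
    \int[mu]_w (g w * \1_[set w | (t < h w)%R] w)%:E =
    (a * expR (- (q * t)))%:E) ->
  \int[mu]_w (g w * disc lam (h w))%:E = (a / (q + lam))%:E.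
Proof.
move=> mg mh g0 h0 q0 lam0 tail.
have a0 : (0 <= a)%R.
  rewrite -lee_fin.
  have <- : \int[mu]_w (g w * \1_[set w | (0 < h w)%R] w)%:E = a%:E.
    by rewrite tail// mulr0 oppr0 expR0 mulr1.
  by apply: integral_ge0 => w _; rewrite lee_fin mulr_ge0.
have mD : measurable [set p : T * R | (0 <= p.2 < h p.1)%R].
  rewrite [X in measurable X](_ : _ = [set p | (0 <= p.2)%R] `&`
    [set p | (p.2 < h p.1)%R]); last first.
    by apply/seteqP; split => p /= => [/andP|[-> ->]].
  apply: measurableI.
  - have : measurable_fun setT (fun p : T * R => (0 <= p.2)%R).
      by apply: measurable_fun_ler => //; exact: measurable_snd.
    by move=> /(_ measurableT [set true] _); rewrite setTI; exact.
  - have : measurable_fun setT (fun p : T * R => (p.2 < h p.1)%R).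
      apply: measurable_fun_ltr; first exact: measurable_snd.
      by apply: measurableT_comp => //; exact: measurable_fst.
    by move=> /(_ measurableT [set true] _); rewrite setTI; exact.
pose f (p : T * R) : \bar R :=
  (g p.1 * (\1_[set p : T * R | (0 <= p.2 < h p.1)%R] p *
     expR (- (lam * p.2))))%:E.
have mf : measurable_fun setT f.
  apply/measurable_EFinP; apply: measurable_funM.
    by apply: measurableT_comp => //; exact: measurable_fst.
  apply: measurable_funM; first exact: measurable_indic.
  apply: (measurableT_comp (f := fun t => expR (- (lam * t))%R)).
    exact: measurable_expRN.
  exact: measurable_snd.
have f0 p : 0 <= f p by rewrite lee_fin !mulr_ge0 ?expR_ge0.
transitivity (\int[mu]_w \int[leb]_t f (w, t)).
  apply: eq_integral => w _; rewrite EFinM -integral_disc// -ge0_integralZl//.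
  - rewrite integral_mkcond; apply: eq_integral => t _.
    rewrite patchE /f /= indicE.
    rewrite (_ : (t \in _) = (0 <= t < h w)%R); last first.
      by apply/idP/idP; rewrite inE/= in_itv.
    case: ifPn => ht; last by rewrite memNset/= ?mul0r ?mulr0//; exact/negP.
    by rewrite mem_set/= ?mul1r.
  - by apply/measurable_EFinP; exact: measurable_expRN.
  - by rewrite lee_fin.
transitivity (\int[leb]_t \int[mu]_w f (w, t)).
  exact: (@fubini_tonelli _ _ _ _ _ mu leb f mf f0).
transitivity (\int[leb]_(t in `[0%R, +oo[) (a%:E * (expR (- ((q + lam) * t)))%:E)).
  rewrite [RHS]integral_mkcond; apply: eq_integral => t _; rewrite patchE.
  rewrite (_ : (t \in _) = (0 <= t)%R); last first.
    by apply/idP/idP; rewrite inE/= in_itv/= andbT.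
  case: ifPn => t0; last first.
    apply: integral0_eq => w _; rewrite /f/= indicE memNset/= ?mul0r ?mulr0//.
    by rewrite (negbTE t0).
  rewrite mulrDl opprD expRD (mulrC (expR _)) -EFinM mulrCA EFinM -tail//.
  rewrite -ge0_integralZl//; last 2 first.
  - by apply/measurable_EFinP; apply: measurable_funM => //;
      apply: measurable_indic; rewrite -[X in measurable X]setTI;
      apply: (measurable_fun_ltr _ mh) => //; exact: measurable_cst.
  - by move=> w _; rewrite lee_fin mulr_ge0.
  apply: eq_integral => w _; rewrite -EFinM /f /= !indicE.
  rewrite (_ : ((w, t) \in _) = (w \in [set w | (t < h w)%R])).
    by congr EFin; ring.
  by apply/idP/idP; rewrite !inE/= t0.
rewrite ge0_integralZl//.
- by rewrite integral_expRN ?EFinM// ltr_wpDr.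
- by apply/measurable_EFinP; exact: measurable_expRN.
Qed.

(** Follows from [integral_exp_tail] through [expR_disc]. The two integrals are added up to [a],
    instead of being subtracted, so that all integrands stay nonnegative. *)
Lemma integral_exp_laplace d (T : measurableType d) (mu : probability T R)
    (g h : T -> R) (a q lam : R) :
  measurable_fun setT g -> measurable_fun setT h ->
  (forall w, 0 <= g w)%R -> (forall w, 0 < h w)%R -> (0 < q)%R -> (0 <= lam)%R ->
  (forall t, (0 <= t)%R ->
    \int[mu]_w (g w * \1_[set w | (t < h w)%R] w)%:E =
    (a * expR (- (q * t)))%:E) ->
  \int[mu]_w (g w * expR (- (lam * h w)))%:E = (a * (q / (q + lam)))%:E.
Proof.
move=> mg mh g0 h0 q0 lam0 tail.
have E := integral_exp_tail mg mh g0 h0 q0 lam0 tail.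
have me : measurable_fun setT (fun w => expR (- (lam * h w))%R).
  apply: (measurableT_comp (f := fun t => expR (- (lam * t))%R)) => //.
  exact: measurable_expRN.
have : \int[mu]_w ((g w * expR (- (lam * h w)))%:E +
    (lam%:E * (g w * disc lam (h w))%:E)) = a%:E.
  rewrite -[a]mulr1 -expR0 -oppr0 -(mulr0 q) -tail//; apply: eq_integral => w _.
  rewrite -EFinM -EFinD expR_disc indicE mem_set; last exact: h0.
  by congr (_%:E) => /=; ring.
rewrite ge0_integralD//; last 4 first.
- by move=> w _; rewrite lee_fin mulr_ge0// expR_ge0.
- by apply/measurable_EFinP; exact: measurable_funM.
- by move=> w _; rewrite -EFinM lee_fin !mulr_ge0// disc_ge0.
- apply: measurable_funeM; apply/measurable_EFinP.
  by apply: measurable_funM => //; exact: measurable_disc.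
rewrite ge0_integralZl//; last 2 first.
- apply/measurable_EFinP; apply: measurable_funM => //.
  exact: measurable_disc.
- by move=> w _; rewrite lee_fin mulr_ge0// disc_ge0.
rewrite E -EFinM; case: (\int[mu]_w _) => [r [ra]| |]//.
congr EFin.
have -> : r = (a - lam * (a / (q + lam)))%R by rewrite -[X in (X - _)%R]ra addrK.
by field; rewrite gt_eqF// ltr_wpDr.
Qed.

End Integration.

(** * Occupation times of the minimal process *)

Section MinimalProcess.
Context {R : realType} {S : countType} {d : measure_display}
  {Omega : measurableType d}.
Variables (Q : S -> S -> R) (P : S -> probability Omega R).
Variables (Y : nat -> Omega -> S) (H : nat -> Omega -> R).
Hypothesis scQ : stable_conservative Q.
Hypothesis q_gt0 : forall x, 0 < exit_rate Q x.
Hypothesis mp : minimal_process P Y H Q.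
Notation q := (exit_rate Q).
Local Open Scope ereal_scope.

Let mY n y : measurable [set w | Y n w = y]. Proof. by case: mp. Qed.
Let mH n : measurable_fun setT (H n). Proof. by case: mp. Qed.
Let H0 n w : (0 < H n w)%R. Proof. by case: mp. Qed.

Definition jump (x y : S) : \bar R := (jump_prob Q x y)%:E.

(* Jump kernel of the process killed at rate [lam]. *)
Definition killed_jump (lam : R) (x y : S) : \bar R :=
  (q x / (q x + lam) * jump_prob Q x y)%:E.

Lemma jump_prob_ge0 x y : (0 <= jump_prob Q x y)%R.
Proof.
rewrite /jump_prob; case: eqVneq => // xy.
by rewrite divr_ge0// ?(ltW (q_gt0 x))//; case: scQ => + _; exact.
Qed.

Lemma jump_ge0 x y : 0 <= jump x y.
Proof. by rewrite lee_fin jump_prob_ge0. Qed.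

Lemma jump_sum x : \esum_(y in [set: S]) jump x y = 1.
Proof.
have [Q0 /(_ x)] := scQ; rewrite esum_mkcond => E.
transitivity (((q x)^-1)%:E * (q x)%:E); last first.
  by rewrite -EFinM mulVf// gt_eqF.
rewrite -E -esumZl.
- apply: eq_esum => y _; rewrite /jump /jump_prob.
  have [->|yx] := eqVneq x y.
    by rewrite memNset ?mule0//= eqxx.
  by rewrite mem_set/= 1?eq_sym// -EFinM mulrC.
- by rewrite lee_fin invr_ge0 ltW.
- by move=> y; case: ifPn => //; rewrite inE/= => yx; rewrite lee_fin Q0// eq_sym.
Qed.

Lemma killed_jump_ge0 lam x y : (0 <= lam)%R -> 0 <= killed_jump lam x y.
Proof.
move=> l0; rewrite lee_fin mulr_ge0 ?jump_prob_ge0//.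
by rewrite divr_ge0 ?addr_ge0 ?(ltW (q_gt0 x)).
Qed.

Lemma killed_jump_le lam x y : (0 <= lam)%R -> killed_jump lam x y <= jump x y.
Proof.
move=> l0; rewrite lee_fin ler_piMl ?jump_prob_ge0//.
by rewrite ler_pdivrMr ?mul1r ?lerDl// ltr_wpDr.
Qed.

Lemma killed_jump0 : killed_jump 0%R = jump.
Proof.
apply/funext => x; apply/funext => y; rewrite /killed_jump /jump.
by rewrite addr0 divff ?mul1r// gt_eqF.
Qed.

(** The initial state is not tested, in agreement with [krestr], which restricts targets only. The
    exponentials multiply up to the discount at the [j]-th jump time. *)
Definition weight (A : set S) (lam : R) (j : nat) (w : Omega) : R :=
  (\prod_(k < j) (\1_A (Y k.+1 w) * expR (- (lam * H k w))))%R.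

(** A cylinder read from the [j]-th jump on; as in [minimal_process], the holding time in its last
    state is left free. *)
Definition cyl (j m : nat) (y : nat -> S) (s : nat -> R) : set Omega :=
  [set w | (forall i, (i <= m)%N -> Y (j + i) w = y i) /\
           (forall i, (i < m)%N -> (s i < H (j + i) w)%R)].

Lemma measurable_Y n (A : set S) : measurable [set w | A (Y n w)].
Proof.
rewrite [X in measurable X](_ : _ =
    \bigcup_(y in A) [set w | Y n w = y]).
  rewrite bigcup_mkcond; apply: countable_bigcupT_measurable => [|y].
    exact: countableP.
  by case: ifP => // _; exact: mY.
by apply/seteqP; split => [w Aw|w [y Ay /= ->]//]; exists (Y n w).
Qed.

Lemma measurable_indicY n (A : set S) :
  measurable_fun setT (fun w => \1_A (Y n w) : R).
Proof.
rewrite (_ : (fun _ => _) = \1_[set w | A (Y n w)]); last exact/funext.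
by apply: measurable_indic; exact: measurable_Y.
Qed.

Lemma measurable_weight A lam j : measurable_fun setT (weight A lam j).
Proof.
apply: measurable_prod => i _; apply: measurable_funM.
  exact: measurable_indicY.
apply: (measurableT_comp (f := fun t => expR (- (lam * t))%R)) => //.
exact: measurable_expRN.
Qed.

Lemma weight_ge0 A lam j w : (0 <= weight A lam j w)%R.
Proof. by apply: prodr_ge0 => i _; rewrite mulr_ge0 ?expR_ge0. Qed.

Lemma measurable_gtH n t : measurable [set w | (t < H n w)%R].
Proof.
rewrite -[X in measurable X]setTI.
by apply: (measurable_fun_ltr _ (mH n)) => //; exact: measurable_cst.
Qed.

Lemma measurable_cyl j m y s : measurable (cyl j m y s).
Proof.
rewrite [X in measurable X](_ : _ =
   (\bigcap_(i in [set i | (i <= m)%N]) [set w | Y (j + i) w = y i]) `&`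
   (\bigcap_(i in [set i | (i < m)%N]) [set w | (s i < H (j + i) w)%R])).
  by apply: measurableI; apply: bigcap_measurableType => i _ //; exact: measurable_gtH.
by apply/seteqP; split => w.
Qed.

Lemma krestr_killed_ge0 A (lam : R) x y : (0 <= lam)%R ->
  0 <= krestr A (killed_jump lam) x y.
Proof. by move=> l0; apply: krestr_ge0 => *; exact: killed_jump_ge0. Qed.

Lemma iter_killed_ge0 A (lam : R) x j y : (0 <= lam)%R ->
  0 <= iter j (step (krestr A (killed_jump lam))) (mdirac x) y.
Proof.
move=> l0; apply: iter_step_ge0 => [*|?]; last exact: mdirac_ge0.
exact: krestr_killed_ge0.
Qed.

Lemma iter_killed_fin_num A (lam : R) x j y : (0 <= lam)%R ->
  iter j (step (krestr A (killed_jump lam))) (mdirac x) y \is a fin_num.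
Proof.
move=> l0; have nu0 z := iter_killed_ge0 A x j z l0.
rewrite ge0_fin_numE//; apply: (@le_lt_trans _ _ 1); last exact: ltry.
apply: le_trans (esum_ge1 y nu0) _.
apply: esum_iter_step_le1 => [*|z]; first exact: krestr_killed_ge0.
rewrite -[leRHS](jump_sum z); apply: le_esum => w _.
by rewrite /krestr; case: ifP => _; [exact: killed_jump_le|exact: jump_ge0].
Qed.

Lemma indicY j w z : \1_[set w0 | Y j w0 = z] w = (z == Y j w)%:R :> R.
Proof.
by rewrite indicE; congr ((nat_of_bool _)%:R); apply/idP/eqP; rewrite inE/= => ->.
Qed.

(* A fixed cylinder follows the random prefix so that, by induction on [j], the
   [j]-th jump can be moved from the cylinder into the weight: integrate
   [H j] out, then sum over [Y j]. *)
Lemma weight_law (x : S) A lam j m y s :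
  (0 <= lam)%R -> (forall i, (0 <= s i)%R) ->
  \int[P x]_w (weight A lam j w * \1_(cyl j m y s) w)%:E =
  iter j (step (krestr A (killed_jump lam))) (mdirac x) (y 0%N) *
  (\prod_(i < m) (expR (- (q (y i) * s i)) * jump_prob Q (y i) (y i.+1)))%:E.
Proof.
move=> lam0; set k := krestr A (killed_jump lam).
have k0 a b : 0 <= k a b by exact: krestr_killed_ge0.
have nu0 i b : 0 <= iter i (step k) (mdirac x) b by exact: iter_killed_ge0.
have nufin i b : iter i (step k) (mdirac x) b \is a fin_num.
  exact: iter_killed_fin_num.
elim: j m y s => [|j IH] m y s s0.
  have [_ _ _ /(_ x m y s s0) law] := mp.
  under eq_integral do rewrite /weight big_ord0 mul1r.
  rewrite integral_indic ?setIT//; last exact: measurable_cyl.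
  by apply: (eq_trans law); rewrite /= /mdirac EFinM; case: eqP.
pose cons T (z : T) (f : nat -> T) i := if i is i'.+1 then f i' else z.
set rest := (\prod_(i < m) _)%R.
have rest0 : (0 <= rest)%R.
  by apply: prodr_ge0 => i _; rewrite mulr_ge0 ?expR_ge0 ?jump_prob_ge0.
pose g z w := (weight A lam j w *
  \1_([set w | Y j w = z] `&` cyl j.+1 m y s) w)%R.
have mg z : measurable_fun setT (g z).
  apply: measurable_funM; first exact: measurable_weight.
  by apply: measurable_indic; apply: measurableI => //; exact: measurable_cyl.
have g0 z w : (0 <= g z w)%R by rewrite mulr_ge0 ?weight_ge0.
pose a z := (fine (iter j (step k) (mdirac x) z) * (jump_prob Q z (y 0%N) * rest))%R.
(* With [Y j] frozen at [z], the constraint [t < H j] extends the cylinder by one state at its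
   front, so the induction hypothesis applies and shows an exponential tail of parameter [q z]. *)
have tail z t : (0 <= t)%R ->
    \int[P x]_w (g z w * \1_[set w | (t < H j w)%R] w)%:E =
    (a z * expR (- (q z * t)))%:E.
  move=> t0; transitivity (\int[P x]_w
      (weight A lam j w * \1_(cyl j m.+1 (cons _ z y) (cons _ t s)) w)%:E).
    apply: eq_integral => w _; rewrite /g -mulrA; congr (_ * _)%:E.
    rewrite -(_ : \1_(([set w | Y j w = z] `&` cyl j.+1 m y s) `&`
       [set w | (t < H j w)%R]) w = \1_([set w | Y j w = z] `&` cyl j.+1 m y s) w *
       \1_[set w | (t < H j w)%R] w :> R)%R; last by rewrite indicI.
    congr (\1_ _ w); apply/seteqP; split => [w' [[/= Yj [Y1 H1]] Hj]|w' [Y1 H1]].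
      split=> -[|i] im /=; rewrite ?addn0 ?addnS//.
        by rewrite -addSn; exact: Y1.
      by rewrite -addSn; exact: H1.
    split; [split|] => /=.
    - by have := Y1 0%N isT; rewrite addn0.
    - split=> i im; rewrite addSnnS; [exact: (Y1 i.+1)|exact: (H1 i.+1)].
    - by have := H1 0%N isT; rewrite addn0.
  rewrite IH; last by case.
  rewrite big_ord_recl/= /a -/rest -[X in X * _]fineK// -EFinM.
  by congr (_%:E); ring.
transitivity (\int[P x]_w \esum_(z in [set: S])
    (g z w * expR (- (lam * H j w)) * \1_A (y 0%N))%:E).
  apply: eq_integral => w _.
  rewrite -(@esum_dirac _ _ (fun=> (weight A lam j.+1 w * \1_(cyl j.+1 m y s) w)%:E)
    (Y j w)); last by rewrite lee_fin mulr_ge0 ?weight_ge0.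
  apply: eq_esum => z _; rewrite /g indicI /=.
  rewrite [\1_[set w0 | Y j w0 = z] w]indicY.
  have [_|_] := eqVneq z (Y j w); last by rewrite !(mul0r, mulr0).
  rewrite /weight big_ord_recr/= mul1r.
  congr (_%:E); rewrite [\1_(cyl _ _ _ _) w]indicE; case: (boolP (w \in cyl j.+1 m y s)) => [|_].
    rewrite inE => -[/(_ 0%N isT)]; rewrite addn0 => -> _; rewrite /=; ring.
  by rewrite /= !(mulr0, mul0r).
rewrite integral_esum//; last 2 first.
- move=> z; apply/measurable_EFinP; apply: measurable_funM => //.
  apply: measurable_funM => //.
  apply: (measurableT_comp (f := fun t => expR (- (lam * t))%R)) => //.
  exact: measurable_expRN.
- move=> z w; rewrite lee_fin; apply: mulr_ge0 => //.
  by apply: mulr_ge0 => //; exact: expR_ge0.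
rewrite /= {2}/step -esumZr ?lee_fin//; last by move=> *; rewrite mule_ge0.
apply: eq_esum => z _.
under eq_integral do rewrite EFinM muleC.
rewrite ge0_integralZl//; last 2 first.
- apply/measurable_EFinP; apply: measurable_funM => //.
  apply: (measurableT_comp (f := fun t => expR (- (lam * t))%R)) => //.
  exact: measurable_expRN.
- by move=> w _; rewrite lee_fin; apply: mulr_ge0 => //; exact: expR_ge0.
rewrite (integral_exp_laplace (mg z) (mH j) (g0 z) (H0 j) (q_gt0 z) lam0 (tail z)).
rewrite /a /k /krestr -[in RHS](fineK (nufin j z)) indicE.
case: (y 0%N \in A); last by rewrite mul0e mule0 mul0e.
rewrite /killed_jump -!EFinM; congr (_%:E) => /=; ring.
Qed.

Section Visits.
Variables (x : S) (A : set S) (lam : R).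
Hypothesis lam0 : (0 <= lam)%R.
Let k := krestr A (killed_jump lam).

(** A cylinder constrains [H j] only when it also prescribes the next state. Prescribe [Y j.+1 = z]
    and sum over [z]: by [jump_sum] the jump probabilities add up to 1. *)
Lemma weight_tail j y t : (0 <= t)%R ->
  \int[P x]_w (weight A lam j w * \1_[set w | Y j w = y] w *
    \1_[set w | (t < H j w)%R] w)%:E =
  iter j (step k) (mdirac x) y * (expR (- (q y * t)))%:E.
Proof.
move=> t0; pose yz z (i : nat) := if i is 0%N then y else z.
transitivity (\int[P x]_w \esum_(z in [set: S])
    (weight A lam j w * \1_(cyl j 1 (yz z) (fun=> t)) w)%:E).
  apply: eq_integral => w _.
  rewrite -(@esum_dirac _ _ (fun=> (weight A lam j w * \1_[set w | Y j w = y] w *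
    \1_[set w | (t < H j w)%R] w)%:E) (Y j.+1 w)); last first.
    by rewrite lee_fin !mulr_ge0 ?weight_ge0.
  apply: eq_esum => z _.
  rewrite (_ : cyl _ _ _ _ = [set w | Y j w = y] `&` [set w | (t < H j w)%R] `&`
      [set w | Y j.+1 w = z]); last first.
    apply/seteqP; split => [w' [Y1 H1]|w' [[/= Yj Hj] Yz]].
      split; [split|] => /=.
      - by have := Y1 0%N isT; rewrite addn0.
      - by have := H1 0%N isT; rewrite addn0.
      - by have := Y1 1%N isT; rewrite addn1.
    by split=> [[|[|//]]|[|//]] _; rewrite ?addn0 ?addn1.
  rewrite !indicI /= [\1_[set w0 | Y j.+1 w0 = z] w]indicY.
  by case: eqVneq => _; rewrite /= ?mulr0// mulr1 mulrA.
rewrite integral_esum//; last 2 first.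
- move=> z; apply/measurable_EFinP; apply: measurable_funM => //.
    exact: measurable_weight.
  by apply: measurable_indic; exact: measurable_cyl.
- by move=> z w; rewrite lee_fin mulr_ge0 ?weight_ge0.
transitivity (\esum_(z in [set: S]) (iter j (step k) (mdirac x) y *
    (expR (- (q y * t)))%:E * jump y z)).
  by apply: eq_esum => z _; rewrite weight_law// big_ord1 EFinM muleA.
by rewrite esumZl ?jump_sum ?mule1// ?mule_ge0 ?iter_killed_ge0 ?lee_fin ?expR_ge0//;
  exact: jump_ge0.
Qed.

(** Mean discounted length of the [j]-th sojourn, counted when it is spent in [y]. Summed over [j],
    the right-hand side becomes [green] divided by [q y + lam]. *)
Lemma weight_disc j y :
  \int[P x]_w (weight A lam j w * \1_[set w | Y j w = y] w * disc lam (H j w))%:E =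
  iter j (step k) (mdirac x) y * ((q y + lam)^-1)%:E.
Proof.
rewrite -[X in X * _]fineK ?iter_killed_fin_num// -EFinM.
apply: (integral_exp_tail (q := q y)) => //.
- by apply: measurable_funM; [exact: measurable_weight|exact: measurable_indic].
- by move=> w; rewrite mulr_ge0 ?weight_ge0.
- by move=> t t0; rewrite weight_tail// EFinM fineK// iter_killed_fin_num.
Qed.

End Visits.

(** * Jump times, sojourn intervals and occupation along a path *)

Notation T := (jump_time H).

Lemma jump_timeS n w : T n.+1 w = (T n w + H n w)%R.
Proof. by rewrite /jump_time big_ord_recr. Qed.

Lemma jump_time_ge0 n w : (0 <= T n w)%R.
Proof. by apply: sumr_ge0 => i _; rewrite ltW. Qed.

Lemma jump_time_lt n w : (T n w < T n.+1 w)%R.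
Proof. by rewrite jump_timeS ltrDl. Qed.

Lemma jump_time_le m n w : (m <= n)%N -> (T m w <= T n w)%R.
Proof.
move=> mn; rewrite -(subnKC mn); elim: (n - m)%N => [|i IH]; first by rewrite addn0.
by rewrite addnS (le_trans IH)// ltW// jump_time_lt.
Qed.

Lemma jump_time_inj m n w t :
  (T m w <= t < T m.+1 w)%R -> (T n w <= t < T n.+1 w)%R -> m = n.
Proof.
wlog mn : m n / (m <= n)%N => [wl|].
  by move=> hm hn; case/orP: (leq_total m n) => mn; [|apply/esym]; exact: wl.
move=> /andP[_ h1] /andP[h2 _]; apply/eqP; rewrite eqn_leq mn/= leqNgt.
apply/negP => /(jump_time_le w) h3.
by have := lt_le_trans h1 (le_trans h3 h2); rewrite ltxx.
Qed.

(** The sojourn intervals are disjoint, so the set from which [xget] picks has at most one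
    element. *)
Lemma state_atP t w y : state_at Y H t w = Some y <->
  exists n, (T n w <= t < T n.+1 w)%R /\ Y n w = y.
Proof.
rewrite /state_at; split=> [|[n [tn Yn]]].
  by case: xgetP => // _ -> [n /= tn <-] [<-]; exists n.
case: xgetP => [_ -> [m /= tm <-]|/(_ (Some (Y n w)))]; last first.
  by case; exists n.
by rewrite (jump_time_inj tm tn) Yn.
Qed.

Lemma measurable_jump_time n : measurable_fun setT (T n).
Proof. exact: measurable_sum. Qed.

Lemma weight_expR A lam n w : weight A lam n w =
  ((\prod_(k < n) \1_A (Y k.+1 w)) * expR (- (lam * T n w)))%R.
Proof.
elim: n => [|n IH].
  by rewrite /weight /jump_time !big_ord0 mulr0 oppr0 expR0 mulr1.
rewrite /weight big_ord_recr/= -/(weight A lam n w) IH jump_timeS big_ord_recr/=.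
rewrite mulrDr opprD expRD; ring.
Qed.

Notation leb := (@lebesgue_measure R).

(** Each [t] lies in at most one sojourn interval, and in none after an explosion. The integrand is
    thus a sum over the sojourns selected by [b], which is integrated term by term. *)
Lemma path_occupation (b : pred nat) w (lam : R) : (0 <= lam)%R ->
  \int[leb]_(t in `[0%R, +oo[) (expR (- (lam * t)) *
    \1_[set t | exists n, (T n w <= t < T n.+1 w)%R /\ b n] t)%:E =
  \sum_(n <oo) ((b n)%:R * (expR (- (lam * T n w)) * disc lam (H n w)))%:E.
Proof.
move=> lam0; rewrite nneseries_esumT; last first.
  by move=> n; rewrite lee_fin !mulr_ge0 ?expR_ge0 ?disc_ge0.
transitivity (\int[leb]_(t in `[0%R, +oo[) \esum_(n in [set: nat])
   ((b n)%:R%:E * ((fun t => (expR (- (lam * t)))%:E) \_ `[T n w, T n.+1 w[) t)).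
  apply: eq_integral => t _.
  have p0 n : 0 <= (b n)%:R%:E *
      ((fun t => (expR (- (lam * t)))%:E) \_ `[T n w, T n.+1 w[) t.
    by rewrite mule_ge0// patchE; case: ifP => // _; rewrite lee_fin expR_ge0.
  have pE n : (T n w <= t < T n.+1 w)%R -> (b n)%:R%:E *
      ((fun t => (expR (- (lam * t)))%:E) \_ `[T n w, T n.+1 w[) t =
      (expR (- (lam * t)) * (b n)%:R)%:E.
    by move=> tn; rewrite patchE mem_set ?[in RHS]EFinM 1?muleC//= in_itv.
  have pN n : ~ (T n w <= t < T n.+1 w)%R -> (b n)%:R%:E *
      ((fun t => (expR (- (lam * t)))%:E) \_ `[T n w, T n.+1 w[) t = 0.
    by move=> tn; rewrite patchE memNset ?mule0//= in_itv.
  have [[n tn]|nt] := pselect (exists n, (T n w <= t < T n.+1 w)%R); last first.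
    rewrite esum1; last by move=> n _; apply: pN => tn; apply: nt; exists n.
    by rewrite indicE memNset ?mulr0// => -[n [tn _]]; apply: nt; exists n.
  rewrite [RHS](_ : _ = \esum_(i in [set: nat])
      (if i == n then (expR (- (lam * t)) * (b n)%:R)%:E else 0)).
    rewrite (esum_dirac (f := fun=> (expR (- (lam * t)) * (b n)%:R)%:E)).
      congr (_ * _)%:E; rewrite indicE; congr ((nat_of_bool _)%:R).
      apply/idP/idP; rewrite inE/=; last by exists n.
      by case=> m [tm]; rewrite (jump_time_inj tm tn).
    by rewrite lee_fin mulr_ge0 ?expR_ge0.
  apply: eq_esum => i _; case: eqVneq => [->|ni]; first exact: pE.
  by apply: pN => ti; move: ni; rewrite (jump_time_inj ti tn) eqxx.
have mp_ n : measurable_fun (`[0%R, +oo[%classic : set R) (fun t => (b n)%:R%:E *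
    ((fun t => (expR (- (lam * t)))%:E) \_ `[T n w, T n.+1 w[) t).
  apply: measurable_funeM; apply: measurable_funTS.
  apply/(measurable_restrictT _ _).1 => //.
  by apply/measurable_EFinP; exact: measurable_expRN.
have p0 n t : 0 <= ((fun t => (expR (- (lam * t)))%:E) \_ `[T n w, T n.+1 w[) t.
  by rewrite patchE; case: ifP => // _; rewrite lee_fin expR_ge0.
rewrite integral_esum//; last by move=> n t; rewrite mule_ge0.
apply: eq_esum => n _; rewrite ge0_integralZl//; last first.
  apply: measurable_funTS.
  apply/(measurable_restrictT _ _).1 => //.
  by apply/measurable_EFinP; exact: measurable_expRN.
rewrite EFinM; congr (_ * _).
rewrite -integral_disc_shift ?jump_time_ge0// -jump_timeS.
rewrite [RHS]integral_mkcond [LHS]integral_mkcond; apply: eq_integral => t _.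
rewrite !patchE; case: ifPn => // t0; case: ifPn => //.
rewrite inE/= in_itv/= => /andP[tn _]; move: t0; rewrite notin_setE/= in_itv/= andbT.
by case; exact: le_trans (jump_time_ge0 n w) tn.
Qed.

Lemma measurable_occupation (b : pred nat) w :
  measurable [set t | exists n, (T n w <= t < T n.+1 w)%R /\ b n].
Proof.
rewrite [X in measurable X](_ : _ = \bigcup_(n in b) `[T n w, T n.+1 w[%classic).
  by apply: bigcup_measurable => n _; exact: measurable_itv.
apply/seteqP; split => t.
  by case=> n [tn bn]; exists n => //=; rewrite in_itv.
by case=> n bn /=; rewrite in_itv => tn; exists n.
Qed.

Lemma first_time_gt C n t w : (T n w <= t < T n.+1 w)%R ->
  t%:E < first_time Y H 0 C w <-> forall k, (k <= n)%N -> ~ C (Y k w).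
Proof.
move=> tn; split=> [tC k kn Ck|nC].
  have : first_time Y H 0 C w <= (T k w)%:E.
    apply: ereal_inf_lbound; exists (T k w) => //=; split.
      exact: jump_time_ge0.
    by exists (Y k w) => //; apply/state_atP; exists k; rewrite lexx jump_time_lt.
  move=> /(lt_le_trans tC); rewrite lte_fin => h.
  case/andP: tn => t1 _; have := lt_le_trans h (jump_time_le w kn).
  by move=> /lt_le_trans/(_ t1); rewrite ltxx.
(* Without a visit among the first [n + 1] states, no time before [T n.+1 w] qualifies, and [t] is
   strictly smaller than that time. *)
apply: (@lt_le_trans _ _ (T n.+1 w)%:E); first by rewrite lte_fin; case/andP: tn.
apply: le_ereal_inf_tmp => _ [t' [t'0 [y Cy /state_atP[m [tm Ym]]]] <-].
rewrite lee_fin; case: (leqP m n) => [mn|nm].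
  by case: (nC m mn); rewrite Ym.
by apply: le_trans (jump_time_le w nm) _; case/andP: tm.
Qed.

Lemma start_ae x : {ae P x, forall w, Y 0 w = x}.
Proof.
exists (~` [set w | Y 0 w = x]); split => //.
  by apply: measurableC; exact: mY.
rewrite probability_setC; last exact: mY.
have [_ _ _ /(_ x 0%N (fun=> x) (fun=> 0%R) (fun=> lexx _))] := mp.
rewrite eqxx big_ord0 mulr1 => E.
rewrite (_ : P x [set w | Y 0 w = x] = 1) ?subee//.
rewrite -[RHS]E; congr (P x _); apply/seteqP; split => [w /= Yw|w [/(_ 0%N isT)]]//.
by split=> // -[].
Qed.

Lemma prod_indicY A n w :
  (\prod_(k < n) \1_A (Y k.+1 w) = `[< forall k, (k < n)%N -> A (Y k.+1 w) >]%:R :> R)%R.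
Proof.
elim: n => [|n IH]; first by rewrite big_ord0 asboolT.
rewrite big_ord_recr/= IH indicE -natrM mulnb; congr ((nat_of_bool _)%:R).
apply/idP/idP => [/andP[/asboolP h]|/asboolP h].
  rewrite inE => An; apply/asboolP => k; rewrite ltnS leq_eqVlt => /orP[/eqP ->//|].
  exact: h.
apply/andP; split; last by rewrite inE; exact: h.
by apply/asboolP => k kn; apply: h; exact: ltnW.
Qed.

(** The time spent in [y] before [C] is cut into sojourns, each evaluated by [weight_disc] at
    [lam = 0]. Since [weight] ignores the initial state, an indicator of [Y 0] is inserted, then
    removed almost surely by [start_ae]. *)
Lemma expected_time_beforeE C x y : ~ C x -> ~ C y ->
  expected_time_before P Y H C x y =
  green (krestr (~` C) jump) (mdirac x) y * ((q y)^-1)%:E.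
Proof.
move=> Cx Cy; rewrite /expected_time_before.
pose F n w : \bar R :=
  (weight (~` C) 0 n w * \1_[set w | Y n w = y] w * disc 0 (H n w))%:E.
have mF n : measurable_fun setT (F n).
  apply/measurable_EFinP; apply: measurable_funM; last exact: measurable_disc.
  by apply: measurable_funM; [exact: measurable_weight|exact: measurable_indic].
have F0 n w : 0 <= F n w.
  by rewrite lee_fin mulr_ge0 ?disc_ge0// mulr_ge0 ?weight_ge0.
transitivity (\int[P x]_w ((\1_(~` C) (Y 0 w))%:E * \sum_(n <oo) F n w)).
  apply: eq_integral => w _.
  pose b n := `[< Y n w = y /\ forall k, (k <= n)%N -> ~ C (Y k w) >].
  rewrite (_ : [set t | _] = [set t | exists n, (T n w <= t < T n.+1 w)%R /\ b n]).
    have := path_occupation b w (lexx 0%R).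
    under eq_integral do rewrite mul0r oppr0 expR0 mul1r.
    rewrite integral_indic//; last exact: measurable_occupation.
    rewrite setIidl; last first.
      move=> t [n [/andP[tn _] _]]; rewrite /= in_itv/= andbT.
      exact: le_trans (jump_time_ge0 n w) tn.
    move=> ->; rewrite -nneseriesZl_ge0//.
    apply: eq_eseriesr => n _; rewrite /F -EFinM weight_expR prod_indicY indicY.
    congr (_%:E); rewrite (_ : (b n)%:R = (\1_(~` C) (Y 0%N w) *
      `[< forall k, (k < n)%N -> (~` C) (Y k.+1 w) >]%:R * (y == Y n w)%:R)%R); first ring.
    rewrite indicE -!natrM !mulnb; congr ((nat_of_bool _)%:R).
    apply/asboolP/idP => [[<- h]|/andP[/andP[]]].
      rewrite eqxx andbT; apply/andP; split; first by rewrite inE; exact: h.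
      by apply/asboolP => k kn; exact: h.
    rewrite inE => C0 /asboolP h /eqP <-; split=> // -[_|k kn]; first exact: C0.
    exact: h.
  apply/seteqP; split => t /=.
    move=> [t0 tC /state_atP[n [tn Yn]]]; exists n; split => //.
    by apply/asboolP; split => //; exact/(first_time_gt C tn).
  move=> [n [tn /asboolP[Yn nC]]]; split.
  - by case/andP: tn => + _; exact: le_trans (jump_time_ge0 n w).
  - exact/(first_time_gt C tn).
  - by apply/state_atP; exists n.
transitivity (\int[P x]_w \sum_(n <oo) F n w).
  have mS : measurable_fun setT (fun w => \sum_(n <oo) F n w).
    by apply: ge0_emeasurable_sum => // n _.
  apply: ge0_ae_eq_integral => //.
  - apply: emeasurable_funM => //; apply/measurable_EFinP; exact: measurable_indicY.
  - by move=> w _; rewrite mule_ge0// ?lee_fin// nneseries_ge0.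
  - by move=> w _; rewrite nneseries_ge0.
  apply: filterS (start_ae x) => w Y0 _.
  by rewrite Y0 indicE mem_set// mul1e.
rewrite integral_nneseries//.
under eq_eseriesr do rewrite weight_disc// addr0 muleC.
rewrite nneseriesZl_ge0 ?lee_fin ?invr_ge0 ?(ltW (q_gt0 _))//; last first.
  by move=> n; exact: iter_killed_ge0.
by rewrite muleC killed_jump0.
Qed.

(** Joint measurability in path and time, as Tonelli requires: the event is a countable union over
    the number of jumps made. *)
Lemma measurable_state_at y :
  measurable [set p : Omega * R | state_at Y H p.2 p.1 = Some y].
Proof.
rewrite [X in measurable X](_ : _ = \bigcup_n
    (([set p : Omega * R | (T n p.1 <= p.2)%R] `&`
      [set p : Omega * R | (p.2 < T n.+1 p.1)%R]) `&`
      (fst @^-1` [set w | Y n w = y]))); last first.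
  apply/seteqP; split => p; rewrite /= state_atP.
    by move=> [n [/andP[h1 h2] Yn]]; exists n.
  by move=> [n _ [[h1 h2] Yn]]; exists n; rewrite [X in X && _]h1.
have mT m : measurable_fun setT (fun p : Omega * R => T m p.1).
  apply: (measurableT_comp (measurable_jump_time m)); exact: measurable_fst.
apply: bigcup_measurable => n _; apply: measurableI; first apply: measurableI.
- have : measurable_fun setT (fun p : Omega * R => (T n p.1 <= p.2)%R).
    by apply: measurable_fun_ler => //; exact: measurable_snd.
  by move=> /(_ measurableT [set true] _); rewrite setTI; exact.
- have : measurable_fun setT (fun p : Omega * R => (p.2 < T n.+1 p.1)%R).
    by apply: measurable_fun_ltr => //; exact: measurable_snd.
  by move=> /(_ measurableT [set true] _); rewrite setTI; exact.
- by rewrite -[X in measurable X]setTI; exact: measurable_fst.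
Qed.

Lemma measurable_transition_prob x y :
  measurable_fun setT (fun t : R => transition_prob P Y H t x y).
Proof.
have mM := measurable_state_at y.
rewrite (_ : (fun t => _) = fubini_G (P x)
    (fun p => (\1_[set p : Omega * R | state_at Y H p.2 p.1 = Some y] p)%:E)).
  apply: measurable_fun_fubini_tonelli_G => [|p]; last by rewrite lee_fin.
  by apply/measurable_EFinP; exact: measurable_indic.
apply/funext => t; rewrite /fubini_G integral_indic ?setIT//.
rewrite -[X in measurable X]setTI; exact: (measurable_pair2 t).
Qed.

(** By Tonelli the left-hand side is the mean discounted time spent in [y]; [path_occupation] cuts
    it into sojourns and [weight_disc] evaluates them. *)
Lemma transition_laplace (lam : R) x y : (0 <= lam)%R ->
  \int[leb]_(t in `[0%R, +oo[) ((expR (- (lam * t)))%:E * transition_prob P Y H t x y) =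
  green (killed_jump lam) (mdirac x) y * ((q y + lam)^-1)%:E.
Proof.
move=> lam0; pose M : set (Omega * R) :=
  [set p | state_at Y H p.2 p.1 = Some y].
have mM : measurable M := measurable_state_at y.
pose e t : \bar R := (fun t => (expR (- (lam * t)))%:E) \_ `[0%R, +oo[ t.
have e0 t : 0 <= e t by rewrite /e patchE; case: ifP => // _; rewrite lee_fin expR_ge0.
have me : measurable_fun setT e.
  apply/(measurable_restrictT _ _).1 => //.
  by apply/measurable_EFinP; exact: measurable_expRN.
pose f (p : Omega * R) := e p.2 * (\1_M p)%:E.
have f0 p : 0 <= f p by rewrite mule_ge0// lee_fin.
have mf : measurable_fun setT f.
  apply: emeasurable_funM; last by apply/measurable_EFinP; exact: measurable_indic.
  by apply: measurableT_comp => //; exact: measurable_snd.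
transitivity (\int[leb]_t \int[P x]_w f (w, t)).
  rewrite integral_mkcond; apply: eq_integral => t _.
  rewrite /f/= /e !patchE; case: ifPn => _; last first.
    by rewrite integral0_eq// => w _; rewrite mul0e.
  rewrite ge0_integralZl//; last first.
    apply/measurable_EFinP.
    apply: (measurableT_comp (f := \1_M : _ -> R)); first exact: measurable_indic.
    exact: measurable_pair2.
  rewrite integral_indic ?setIT// -[X in measurable X]setTI.
  exact: (measurable_pair2 t).
transitivity (\int[P x]_w \int[leb]_t f (w, t)).
  by apply/esym; exact: (@fubini_tonelli _ _ _ _ _ (P x) leb f mf f0).
transitivity (\int[P x]_w \sum_(n <oo)
   (weight setT lam n w * \1_[set w | Y n w = y] w * disc lam (H n w))%:E).
  apply: eq_integral => w _.
  transitivity (\int[leb]_(t in `[0%R, +oo[) (expR (- (lam * t)) *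
      \1_[set t | exists n, (T n w <= t < T n.+1 w)%R /\ (y == Y n w)] t)%:E).
    rewrite [RHS]integral_mkcond; apply: eq_integral => t _.
    rewrite /f/= /e !patchE; case: ifP => _; last by rewrite mul0e.
    rewrite -EFinM; congr (_ * _)%:E; rewrite !indicE; congr ((nat_of_bool _)%:R).
    apply/idP/idP; rewrite !inE/= /M/= state_atP => -[n [tn Yn]]; exists n; split => //.
      by rewrite Yn.
    by rewrite (eqP Yn).
  rewrite path_occupation//; apply: eq_eseriesr => n _.
  rewrite weight_expR prod_indicY asboolT// indicY; congr (_%:E) => /=; ring.
rewrite integral_nneseries//; last 2 first.
- move=> n; apply/measurable_EFinP; apply: measurable_funM; last exact: measurable_disc.
  by apply: measurable_funM; [exact: measurable_weight|exact: measurable_indic].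
- by move=> n w _; rewrite lee_fin mulr_ge0 ?disc_ge0// mulr_ge0 ?weight_ge0.
under eq_eseriesr do rewrite weight_disc// muleC.
rewrite nneseriesZl_ge0; last 2 first.
- by rewrite lee_fin invr_ge0 addr_ge0 ?(ltW (q_gt0 _)).
- by move=> n; exact: iter_killed_ge0.
rewrite muleC /green; congr (_ * _).
by rewrite (_ : krestr setT (killed_jump lam) = killed_jump lam)//;
  apply/funext => a; apply/funext => b; rewrite /krestr in_setT.
Qed.

(** * Return times and lengths of excursions *)

Section ReturnTime.
Variable x : S.
Let ret w := first_time Y H (T 1 w) [set x] w.
Let hit n w : \bar R := if Y n.+1 w == x then (T n.+1 w)%:E else +oo.

(* A countable infimum, hence measurable. *)
Lemma return_timeE w : ret w = einfs (fun n => hit n w) 0%N.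
Proof.
apply/eqP; rewrite eq_le; apply/andP; split.
  apply: le_ereal_inf_tmp => _ [n _ <-]; rewrite /hit.
  case: eqP => [Yn|_]; last by rewrite leey.
  apply: ereal_inf_lbound; exists (T n.+1 w) => //=; split.
    exact: jump_time_le.
  by exists x => //; apply/state_atP; exists n.+1; rewrite lexx jump_time_lt.
apply: le_ereal_inf_tmp => _ [t [t1 [_ -> /state_atP[[|n] [/andP[tn tn'] Yn]]]] <-].
  (* A time at or after the first jump does not belong to sojourn 0. *)
  by have := le_lt_trans t1 tn'; rewrite ltxx.
apply: (@le_trans _ _ (hit n w)); first by apply: ereal_inf_lbound; exists n.
by rewrite /hit Yn eqxx lee_fin.
Qed.

Lemma measurable_return_time : measurable_fun setT ret.
Proof.
rewrite (_ : ret = fun w => einfs (hit ^~ w) 0%N); last first.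
  by apply/funext => w; exact: return_timeE.
apply: measurable_fun_einfs => n.
apply: measurable_fun_ifT => //.
  apply: (measurable_fun_bool true); rewrite setTI.
  rewrite (_ : _ @^-1` _ = [set w | Y n.+1 w = x]); first exact: mY.
  by apply/seteqP; split => w /eqP.
by apply/measurable_EFinP; exact: measurable_jump_time.
Qed.

Let A := ~` [set x].
(** The length of the first excursion from [x]: the initial sojourn always counts, and every term
    from the return on vanishes. *)
Let Z w := \sum_(n <oo) (weight A 0 n w * H n w)%:E.

Let term0 n w : (0 <= weight A 0 n w * H n w)%R.
Proof. by rewrite mulr_ge0 ?weight_ge0// ltW. Qed.

Let weight0E n w : weight A 0 n w = `[< forall k, (k < n)%N -> Y k.+1 w <> x >]%:R :> R.
Proof. by rewrite weight_expR mul0r oppr0 expR0 mulr1 prod_indicY. Qed.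

Let sum_le N w : (\sum_(0 <= n < N) weight A 0 n w * H n w <= T N w)%R.
Proof.
rewrite /jump_time big_mkord; apply: ler_sum => i _.
by rewrite ler_piMl ?(ltW (H0 _ _))// weight0E; case: `[< _ >].
Qed.

(** Sojourns counted before a return at jump [n.+1] add up to at most [T n.+1 w]. The inequality is
    strict on a path that explodes without returning: its excursion has finite length but its return
    time is infinite. *)
Lemma excursion_le_return_time w : Z w <= ret w.
Proof.
rewrite return_timeE; apply: le_ereal_inf_tmp => _ [n _ <-]; rewrite /hit.
case: eqP => [Yn|_]; last by rewrite leey.
apply: nneseries_le => [m|N]; first by rewrite lee_fin.
rewrite sumEFin lee_fin; have [Nn|nN] := leqP N n.+1.
  exact: le_trans (sum_le N w) (jump_time_le w Nn).
rewrite (big_cat_nat (n := n.+1))//=; last exact: ltnW.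
rewrite [X in (_ + X)%R](_ : _ = 0%R) ?addr0; first exact: sum_le.
rewrite big_nat_cond big1//.
move=> m /andP[/andP[nm _] _]; rewrite weight0E asboolF ?mul0r// => /(_ n nm).
exact.
Qed.

(** If the path returns, the sojourns up to the first return already add up to it. If it never does,
    the partial sums of [Z] are the jump times, which diverge. *)
Lemma return_time_le_excursion w :
  jump_time H n w @[n --> \oo] --> +oo%R -> ret w <= Z w.
Proof.
move=> Too; have Z0 m : 0 <= (weight A 0 m w * H m w)%:E by rewrite lee_fin.
have [hx|nx] := pselect (exists n, Y n.+1 w == x).
  have [n Yn min_n] := ex_minnP hx.
  apply: (@le_trans _ _ (T n.+1 w)%:E).
    rewrite return_timeE; apply: ereal_inf_lbound; exists n => //=.
    by rewrite /hit Yn.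
  rewrite /Z; apply: le_trans (nneseries_lim_ge n.+1 _) => //.
  rewrite sumEFin lee_fin /jump_time big_mkord ler_sum// => i _.
  rewrite weight0E asboolT ?mul1r// => k ki Yk.
  have := min_n k; rewrite Yk eqxx => /(_ isT).
  by rewrite leqNgt (leq_trans ki)// -ltnS.
rewrite (_ : Z w = +oo) ?leey//; apply: eq_infty => r.
move/cvgryPge : Too => /(_ r) [N _ /(_ N (leqnn N))/= rT].
apply: le_trans (nneseries_lim_ge N _) => //.
rewrite sumEFin lee_fin (le_trans rT)// /jump_time big_mkord ler_sum// => i _.
rewrite weight0E asboolT ?mul1r// => k ki Yk; apply: nx; exists k.
by rewrite Yk.
Qed.

Let mZn n : measurable_fun setT (fun w => (weight A 0 n w * H n w)%:E).
Proof. by apply/measurable_EFinP/measurable_funM => //; exact: measurable_weight. Qed.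

Let mZ : measurable_fun setT Z.
Proof. by apply: ge0_emeasurable_sum => // n w _ _; rewrite lee_fin. Qed.

Let Z_ge0 w : 0 <= Z w.
Proof. by apply: nneseries_ge0 => n _ _; rewrite lee_fin. Qed.

Lemma integral_excursion :
  \int[P x]_w Z w = \esum_(y in [set: S])
     (green (krestr A jump) (mdirac x) y * ((q y)^-1)%:E).
Proof.
rewrite integral_nneseries//; last by move=> n w _; rewrite lee_fin.
pose F n y w : \bar R :=
  (weight A 0 n w * \1_[set w | Y n w = y] w * disc 0 (H n w))%:E.
have mF n y : measurable_fun setT (F n y).
  apply/measurable_EFinP; apply: measurable_funM; last exact: measurable_disc.
  by apply: measurable_funM; [exact: measurable_weight|exact: measurable_indic].
have F0 n y w : 0 <= F n y w.
  by rewrite lee_fin mulr_ge0 ?disc_ge0// mulr_ge0 ?weight_ge0.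
transitivity (\sum_(n <oo) \esum_(y in [set: S]) \int[P x]_w F n y w).
  apply: eq_eseriesr => n _; rewrite -integral_esum//; apply: eq_integral => w _.
  rewrite -(@esum_dirac _ _ (fun=> (weight A 0 n w * H n w)%:E) (Y n w)) ?lee_fin//.
  apply: eq_esum => y _; rewrite /F disc0 indicY.
  by case: eqP => _; rewrite /= ?mulr1 ?mulr0 ?mul0r.
rewrite -esum_nneseries; last by move=> n y; exact: integral_ge0.
apply: eq_esum => y _.
under eq_eseriesr do rewrite weight_disc// addr0 muleC.
rewrite nneseriesZl_ge0 ?lee_fin ?invr_ge0 ?(ltW (q_gt0 _))//; last first.
  by move=> n; exact: iter_killed_ge0.
by rewrite muleC killed_jump0.
Qed.

Let ret_ge0 w : 0 <= ret w.
Proof. exact: le_trans (Z_ge0 w) (excursion_le_return_time w). Qed.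

Lemma le_return_time :
  \esum_(y in [set: S]) (green (krestr A jump) (mdirac x) y * ((q y)^-1)%:E) <=
  \int[P x]_w ret w.
Proof.
rewrite -integral_excursion; apply: ge0_le_integral => //.
  exact: measurable_return_time.
by move=> w _; exact: excursion_le_return_time.
Qed.

Lemma return_time_eq : {ae P x, forall w, jump_time H n w @[n --> \oo] --> +oo%R} ->
  \int[P x]_w ret w =
  \esum_(y in [set: S]) (green (krestr A jump) (mdirac x) y * ((q y)^-1)%:E).
Proof.
move=> ne; rewrite -integral_excursion; apply: ge0_ae_eq_integral => //.
  exact: measurable_return_time.
apply: filterS ne => w Tw _; apply/eqP.
by rewrite eq_le return_time_le_excursion// excursion_le_return_time.
Qed.

End ReturnTime.

End MinimalProcess.

(** * Excursions and stationary distributions *)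

Section Irreducible.
Context {R : realType} {S : countType} {d : measure_display}
  {Omega : measurableType d}.
Variables (Q : S -> S -> R) (P : S -> probability Omega R).
Variables (Y : nat -> Omega -> S) (H : nat -> Omega -> R).
Hypothesis scQ : stable_conservative Q.
Hypothesis irrQ : irreducible Q.
Hypothesis S2 : forall x : S, exists y, y != x.
Hypothesis mp : minimal_process P Y H Q.
Notation q := (exit_rate Q).
Notation jump := (jump Q).
Local Open Scope ereal_scope.

(** A path from [x] to some other state begins with a jump of positive rate out of [x]. *)
Lemma exit_rate_gt0 x : (0 < q x)%R.
Proof.
have [y yx] := S2 x; have [[|a p] [/= pth lst]] := irrQ x y.
  by rewrite lst eqxx in yx.
have {pth} /andP[xa Qxa] : (x != a) && (0 < Q x a)%R by case/andP: pth.
have [Q0 E] := scQ; rewrite -lte_fin -E esum_mkcond.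
apply: lt_le_trans (esum_ge1 a _); first by rewrite mem_set/= 1?eq_sym.
by move=> z; case: ifPn => //; rewrite inE/= => zx; rewrite lee_fin Q0// eq_sym.
Qed.

Let j0 := jump_ge0 scQ exit_rate_gt0.
Let j1 x : \esum_(y in [set: S]) jump x y <= 1.
Proof. by rewrite jump_sum//; exact: exit_rate_gt0. Qed.

Lemma jump_path x y : exists p,
  path (fun a b => 0 < jump a b) x p /\ last x p = y.
Proof.
have [p [pth lst]] := irrQ x y; exists p; split => //.
apply: sub_path pth => a b /andP[ab Qab].
by rewrite lte_fin /jump_prob (negbTE ab) divr_gt0// exit_rate_gt0.
Qed.

(** The uniformity in the starting point is what lets the contribution of the starting points in [A]
    vanish with the killing rate. *)
Lemma green_bounded (A : set S) z y : ~ A z -> A y -> exists C : R,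
  forall x, green (krestr A jump) (mdirac x) y <= C%:E.
Proof.
move=> Az Ay; have [p [pth lst]] := jump_path y z.
apply: (green_dirac_bounded j0 j1 pth); last by rewrite inE.
by rewrite lst notin_setE.
Qed.

(* Occupation of [A] is fed only by the jumps entering [A] from outside. *)
Definition fed_from_outside (mu : S -> \bar R) (A : set S) : Prop :=
  forall y, A y ->
    mu y = green (krestr A jump) (step (krestr A jump) (mrestr (~` A) mu)) y.

(** * Occupation measure of the excursions from a state *)

Section Excursion.
Variable x0 : S.
Let B := ~` [set x0].
Let mu := green (krestr B jump) (mdirac x0).

Let jB0 x y : 0 <= krestr B jump x y.
Proof. exact: krestr_ge0. Qed.

Lemma excursion_ge0 y : 0 <= mu y.
Proof. by apply: green_ge0 => // ?; exact: mdirac_ge0. Qed.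

Lemma excursion_start : mu x0 = 1.
Proof.
rewrite /mu greenE//; last exact: mdirac_ge0.
by rewrite step_krestr_out ?adde0 /mdirac ?eqxx// notin_setE => /=; apply.
Qed.

(** At [x0] the left-hand side is a return probability, hence at most [mu x0 = 1]; elsewhere the
    bound is the equation satisfied by [green]. *)
Lemma excursion_excessive y : step jump mu y <= mu y.
Proof.
have [->|yx] := eqVneq y x0.
  rewrite excursion_start; apply: step_green_dirac_le1 => //.
  by rewrite notin_setE => /=; apply.
rewrite /mu [leRHS]greenE//; last exact: mdirac_ge0.
rewrite step_krestr_in ?leeDr ?mdirac_ge0//.
by rewrite inE => /eqP; rewrite (negbTE yx).
Qed.

(** Positivity spreads from [x0] along a path of positive jumps, because [mu] is excessive. *)
Lemma excursion_gt0 y : 0 < mu y.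
Proof.
have [p [pth <-]] := jump_path x0 y; have : 0 < mu x0 by rewrite excursion_start.
elim: p (x0) pth => [|b p IH] a //= /andP[jab pth] mua; apply: IH => //.
apply: lt_le_trans (excursion_excessive b).
apply: lt_le_trans (esum_ge1 a _); first by rewrite mule_gt0.
by move=> z; rewrite mule_ge0 ?excursion_ge0.
Qed.

Lemma excursion_lty y : mu y < +oo.
Proof.
have [->|yx] := eqVneq y x0; first by rewrite excursion_start ltry.
have [||C hC] := @green_bounded B x0 y.
- by move=> /=; apply.
- by move=> /eqP; rewrite (negbTE yx).
exact: le_lt_trans (hC x0) (ltry _).
Qed.

(** Instance of [green_krestr_sub] inside the complement of [x0]: the initial mass sits at [x0],
    outside [A], so only the entrance term remains. *)
Lemma excursion_fed (A : set S) : ~ A x0 -> fed_from_outside mu A.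
Proof.
move=> Ax0 y Ay; rewrite {1}/mu (@green_krestr_sub _ _ _ j0 A B)//.
- congr (green _ _ y); apply/funext => x.
  rewrite -/mu [mrestr A _ _](_ : _ = 0) ?add0e// /mrestr /mdirac.
  by case: ifPn => //; rewrite inE; case: eqP => // ->.
- by move=> x Ax xx0; apply: Ax0; rewrite -xx0.
- by move=> x; exact: mdirac_ge0.
- by rewrite inE.
Qed.

(* [mu] is excessive, and [green] is minimal. *)
Lemma excursion_min x y :
  mu x * green (krestr (~` [set x]) jump) (mdirac x) y <= mu y.
Proof.
rewrite -greenZ ?excursion_ge0//; [|by move=> *; exact: krestr_ge0|exact: mdirac_ge0].
apply: green_min => [||z|]; first by move=> *; exact: krestr_ge0.
- by move=> z; rewrite mule_ge0 ?excursion_ge0 ?mdirac_ge0.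
- exact: excursion_ge0.
- move=> z; rewrite /mdirac; case: eqVneq => [->|zx].
    by rewrite mule1 step_krestr_out ?adde0// notin_setE => /=; apply.
  rewrite mule0 add0e step_krestr_in; first exact: excursion_excessive.
  by rewrite inE => /eqP; rewrite (negbTE zx).
Qed.

End Excursion.

(** * Balance equations of a stationary distribution *)

Section Stationary.
Variable p : S -> R.
Hypothesis stp : stationary_distribution P Y H p.
Notation leb := (@lebesgue_measure R).
Let p0 x : (0 <= p x)%R. Proof. by case: stp. Qed.
Let k0 (lam : R) x y : (0 <= lam)%R -> 0 <= killed_jump Q lam x y.
Proof. by move=> l0; apply: killed_jump_ge0 => //; exact: exit_rate_gt0. Qed.

(** Laplace transform in [t] of the stationarity equation, evaluated by [transition_laplace]. The
    factor [q y + lam] converts occupation times into numbers of visits. *)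
Lemma stationary_resolvent (lam : R) y : (0 < lam)%R ->
  green (killed_jump Q lam) (fun x => (p x)%:E) y =
  (p y * (q y + lam) / lam)%:E.
Proof.
move=> lam0; have l0 := ltW lam0.
have ql : (0 < q y + lam)%R by rewrite addr_gt0// exit_rate_gt0.
have tp0 t x : 0 <= transition_prob P Y H t x y by [].
have me : measurable_fun (`[0%R, +oo[%classic : set R)
    (fun t => (expR (- (lam * t)))%:E).
  by apply/measurable_EFinP; exact: measurable_expRN.
have mt x : measurable_fun (`[0%R, +oo[%classic : set R)
    (fun t => (expR (- (lam * t)))%:E * transition_prob P Y H t x y).
  apply: emeasurable_funM => //; apply: measurable_funTS.
  exact: measurable_transition_prob mp _ _.
have e0 t : 0 <= (expR (- (lam * t)))%:E by rewrite lee_fin expR_ge0.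
have g0 x : 0 <= green (killed_jump Q lam) (mdirac x) y.
  by apply: green_ge0 => [*|?]; [exact: k0|exact: mdirac_ge0].
have : (p y)%:E * (lam^-1)%:E = \int[leb]_(t in `[0%R, +oo[)
    \esum_(x in [set: S])
      ((p x)%:E * ((expR (- (lam * t)))%:E * transition_prob P Y H t x y)).
  rewrite -integral_expRN// -ge0_integralZl//; last by rewrite lee_fin.
  apply: eq_integral => t; rewrite inE/= in_itv/= andbT => t0.
  have [_ _ /(_ t y t0) <-] := stp; rewrite muleC -esumZl//.
    by apply: eq_esum => x _; rewrite muleCA.
  by move=> x; rewrite mule_ge0// lee_fin.
rewrite integral_esum//; last 2 first.
- by move=> x; apply: measurable_funeM; exact: mt.
- by move=> x t; rewrite !mule_ge0// lee_fin.
rewrite (eq_esum (b := fun x => (p x)%:E *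
    green (killed_jump Q lam) (mdirac x) y * ((q y + lam)^-1)%:E)); last first.
  move=> x _; rewrite ge0_integralZl ?lee_fin//.
    by rewrite (transition_laplace scQ exit_rate_gt0 mp)// muleA.
  - exact: mt.
  - by move=> t _; rewrite mule_ge0.
rewrite esumZr ?lee_fin ?invr_ge0 ?ltW//; last by move=> x; rewrite mule_ge0// lee_fin.
rewrite -(green_dirac (fun x z => @k0 lam x z l0)) ?lee_fin// => E.
have := congr1 (fun z => z * (q y + lam)%:E) E.
rewrite -[in RHS]muleA -[in RHS]EFinM mulVf ?gt_eqF// mule1 => <-.
by rewrite -!EFinM mulrAC.
Qed.

(** While [p] measures time, [p q] measures the frequency of visits and is invariant for the jump
    chain. *)
Let mu x := (p x * q x)%:E.

Let mu0 x : 0 <= mu x.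
Proof. by rewrite lee_fin mulr_ge0// ltW// exit_rate_gt0. Qed.

(** Read the Green equation at killing rate 1: the factor [q / (q + 1)] of the killed kernel cancels
    the factor [q + 1] of the resolvent. *)
Lemma stationary_invariant y : step jump mu y = mu y.
Proof.
have p0' x : 0 <= (p x)%:E by rewrite lee_fin.
have := stationary_resolvent y ltr01.
rewrite (greenE (fun x z => @k0 1%R x z ler01))//.
have -> : step (killed_jump Q 1%R) (green (killed_jump Q 1%R) (fun x => (p x)%:E)) y =
    step jump mu y.
  apply: eq_esum => x _; rewrite stationary_resolvent// /mu -!EFinM; congr (_%:E).
  by rewrite divr1; field; rewrite gt_eqF// addr_gt0// exit_rate_gt0.
have : 0 <= step jump mu y by exact: step_ge0.
case: (step jump mu y) => [r _ /=| _ //|//].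
by rewrite -EFinD divr1 mulrDr mulr1 addrC => -[/addIr ->].
Qed.

(* The lower bound is minimality of [green] for the invariant measure [p q].  For
   the upper one, kill at rate [lam]: the mass started inside [A] contributes at
   most [lam * C] by [green_bounded]. *)
Lemma stationary_fed (A : set S) z : ~ A z -> fed_from_outside mu A.
Proof.
move=> Az y Ay; have [C gC] := green_bounded Az Ay.
set kA := krestr A jump; set src := step kA _.
have kA0 x w : 0 <= kA x w by exact: krestr_ge0.
have src0 x : 0 <= src x by apply: step_ge0 => // w; exact: mrestr_ge0.
have g0 : 0 <= green kA src y by exact: green_ge0.
have yA : y \in A by rewrite inE.
apply/eqP; rewrite eq_le; apply/andP; split; last first.
  rewrite -[leRHS](_ : mrestr A mu y = _); last by rewrite mrestrT.
  apply: green_min => // [w|w]; first exact: mrestr_ge0.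
  rewrite /src -stepD//; try by move=> *; exact: mrestr_ge0.
  rewrite mrestrDC; have [wA|wA] := boolP (w \in A).
    by rewrite step_krestr_in// mrestrT// stationary_invariant.
  by rewrite step_krestr_out// mrestr_ge0.
apply/lee_addgt0Pr => e e0.
(* [C'] is positive and at least [C], so that [lam * C <= e]. *)
pose C' := (`|C| + 1)%R; have C'0 : (0 < C')%R by rewrite ltr_wpDl.
pose lam := (e / C')%R; have lam0 : (0 < lam)%R by rewrite divr_gt0.
have l0 := ltW lam0.
pose kl := killed_jump Q lam; pose klA := krestr A kl.
have kl0 x w : 0 <= kl x w by exact: k0.
have klA0 x w : 0 <= klA x w by exact: krestr_ge0.
have klAle x w : klA x w <= kA x w.
  rewrite /klA /kA /krestr; case: ifP => // _.
  by apply: killed_jump_le => //; exact: exit_rate_gt0.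
have pE0 x : 0 <= (p x)%:E by rewrite lee_fin.
pose m x := green kl (fun x => (p x)%:E) x.
have m0 x : 0 <= m x by exact: green_ge0.
(* The visits to [y] of the killed process are split between the mass started in [A] and the mass
   entering [A] by a jump. *)
have mE : m y = green klA (mrestr A (fun x => (p x)%:E)) y +
    green klA (step klA (mrestr (~` A) m)) y.
  rewrite -greenD//; last 2 first.
  - by move=> x; exact: mrestr_ge0.
  - by move=> x; apply: step_ge0 => // w; exact: mrestr_ge0.
  exact: green_sub.
have step1 : mu y <= lam%:E * m y.
  rewrite /m stationary_resolvent// -EFinM lee_fin mulrCA divff ?gt_eqF// mulr1.
  by rewrite ler_wpM2l// lerDl.
apply: le_trans step1 _; rewrite mE ge0_muleDr; last 2 first.
- by apply: green_ge0 => // x; exact: mrestr_ge0.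
- by apply: green_ge0 => // x; apply: step_ge0 => // w; exact: mrestr_ge0.
rewrite addeC; apply: leeD.
  rewrite -greenZ//; last by move=> x; apply: step_ge0 => // w; exact: mrestr_ge0.
  apply: le_trans (le_green_kernel y klA0 klAle src0).
  apply: le_green => // x.
    rewrite mule_ge0 ?lee_fin//; apply: step_ge0 => // w; exact: mrestr_ge0.
  (* Once multiplied by [lam], the flow of the killed process into [A] is exactly that of [p q], the
     killing factor cancelling [q + lam]. *)
  rewrite -stepZ//; last by move=> w; exact: mrestr_ge0.
  apply: le_esum => w _; rewrite /mrestr; case: ifP => _; last by rewrite mule0 !mul0e.
  rewrite /klA /kA /krestr; case: ifP => _; last by rewrite !mule0.
  rewrite /m stationary_resolvent// /kl /killed_jump /jump -!EFinM lee_fin.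
  by rewrite le_eqVlt; apply/orP; left; apply/eqP; field;
    rewrite !gt_eqF// addr_gt0// exit_rate_gt0.
apply: (@le_trans _ _ (lam%:E * C%:E)).
  apply: lee_wpmul2l; first by rewrite lee_fin.
  apply: le_trans (le_green_kernel y klA0 klAle _) _.
    by move=> x; exact: mrestr_ge0.
  have d0 x w : 0 <= (mdirac x w : \bar R) by exact: mdirac_ge0.
  rewrite (green_dirac kA0); last by move=> x; exact: mrestr_ge0.
  have [_ p1 _] := stp; rewrite -[leRHS]mul1e -p1.
  have C0 : (0 <= C)%R by rewrite -lee_fin; apply: le_trans (gC y); exact: green_ge0.
  rewrite -esumZr ?lee_fin//; apply: le_esum => x _.
  rewrite /mrestr; case: ifP => _; last by rewrite mul0e mule_ge0// lee_fin.
  exact: lee_wpmul2l.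
rewrite -EFinM lee_fin /lam -mulrA ler_piMr ?(ltW e0)//.
rewrite mulrC ler_pdivrMr// mul1r /C'.
by rewrite (le_trans (ler_norm C))// lerDl.
Qed.

End Stationary.

End Irreducible.

(** * Levels of the QSF process *)

Section StateSums.
Context {R : realType}.
Local Open Scope ereal_scope.

Lemma esum_pair (A B : choiceType) (F : A * B -> \bar R) : (forall x, 0 <= F x) ->
  \esum_(x in [set: A * B]) F x =
  \esum_(a in [set: A]) \esum_(b in [set: B]) F (a, b).
Proof.
move=> F0; rewrite (esum_esum (J := fun=> setT))//.
rewrite (_ : [set: A] `*`` (fun=> [set: B]) = setT).
  by apply: eq_esum => -[].
by apply/seteqP; split.
Qed.

Lemma esum_fiber (A B : choiceType) (f : B -> \bar R) a0 : (forall x, 0 <= f x) ->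
  \esum_(x in [set: A * B]) (if x.1 == a0 then f x.2 else 0) =
  \esum_(b in [set: B]) f b.
Proof.
move=> f0; rewrite esum_pair; last by move=> x; case: ifP.
rewrite -[RHS](@esum_dirac _ _ (fun=> \esum_(b in [set: B]) f b) a0) ?esum_ge0//.
apply: eq_esum => a _ /=; case: eqP => // _; exact: esum1.
Qed.

Lemma esum_shift (B : choiceType) (F : nat * B -> \bar R) n :
  (forall a b, (a < n)%N -> F (a, b) = 0) -> (forall x, 0 <= F x) ->
  \esum_(x in [set: nat * B]) F x =
  \esum_(x in [set: nat * B]) F ((x.1 + n)%N, x.2).
Proof.
move=> Fn F0; pose e (x : nat * B) := ((x.1 + n)%N, x.2).
rewrite -(reindex_esum [set: nat * B] (range e) e F).
  rewrite [RHS]esum_mkcond; apply: eq_esum => -[a b] _; case: ifPn => //.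
  rewrite notin_setE => h; apply: Fn; rewrite ltnNge; apply/negP => na; apply: h.
  by exists ((a - n)%N, b) => //; rewrite /e/= subnK.
split=> //=; by move=> [a b] [a' b'] _ _ [/addIn -> ->].
Qed.

Lemma phase_sumE l (F : phase l -> \bar R) : (forall i, 0 <= F i) ->
  phase_sum F = \esum_(i in [set: phase l]) F i.
Proof.
move=> F0; rewrite (esum_pcan (e := val) (d := insub))//; first exact: valK.
exact: insubK.
Qed.

(** Serves the case where [c] and [r] are both nonpositive. *)
Lemma phase_sumN l (F : phase l -> \bar R) : (forall i, 0 <= F i) ->
  phase_sum (fun i => - F i) = - phase_sum F.
Proof.
move=> F0; rewrite /phase_sum.
pose f k : \bar R := oapp F 0 (insub k : option (phase l)).
have f0 k : 0 <= f k by rewrite /f; case: insub => /=.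
rewrite -limeN; last by apply: is_cvg_nneseries => k _ _; exact: f0.
apply: congr_lim; apply/funext => n.
rewrite -sumeN; last first.
  by move=> i j _ _; apply: ge0_adde_def; rewrite inE; exact: f0.
by apply: eq_bigr => k _; rewrite /f; case: (insub k) => [i|] //=; rewrite oppr0.
Qed.

Lemma esum_phase_lty l (f : phase l -> \bar R) : l <> None ->
  (forall i, 0 <= f i) -> (forall i, f i < +oo) ->
  \esum_(i in [set: phase l]) f i < +oo.
Proof.
case: l f => [L|//] f _ f0 fy.
rewrite -phase_sumE// /phase_sum.
have g0 k : 0 <= oapp f 0 (insub k : option (phase (Some L))).
  by case: insub => /=.
rewrite (nneseries_split 0 L.+1)// eseries0 ?adde0; last first.
  by move=> k; rewrite add0n => Lk _; rewrite insubN//= -ltnNge.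
by apply: lte_sum_pinfty => k _; case: insub => [i|] /=; rewrite ?ltry.
Qed.

Lemma geometric_lty (g : \bar R) : 0 <= g -> g < 1 ->
  \sum_(n <oo) g ^+ n < +oo.
Proof.
case: g => [g| |]//; rewrite lee_fin lte_fin => g0 g1.
apply: (@le_lt_trans _ _ ((1 - g)^-1)%:E); last exact: ltry.
apply: nneseries_le => [n|N]; first exact: expe_ge0.
under eq_bigr do rewrite -EFin_expe.
rewrite sumEFin lee_fin -[leRHS]mul1r ler_pdivlMr ?subr_gt0//.
rewrite mulrC -opprB mulNr big_mkord -subrX1 opprB lerBlDr lerDl.
exact: exprn_ge0.
Qed.

End StateSums.

(** * Homogeneity in the level and the geometric recursion *)

Section Levels.
Context {R : realType} {l : option nat}.
Variables (D W W' : phase l -> phase l -> R) (U U' : nat -> phase l -> phase l -> R).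
Variables (c r : phase l -> R).
Hypothesis DE : forall i j, D i j = (c i * r j)%R.
Hypothesis c0 : forall i, (0 <= c i)%R.
Hypothesis r0 : forall j, (0 <= r j)%R.
Let Q := qsf_matrix D W U W' U'.
Hypothesis scQ : stable_conservative Q.
Hypothesis irrQ : irreducible Q.
Local Open Scope ereal_scope.
Notation q := (exit_rate Q).
Notation J := (jump Q).

Lemma two_states (x : state l) : exists y, y != x.
Proof.
exists (x.1.+1, x.2); apply/eqP => /(congr1 fst)/=/eqP.
by rewrite gtn_eqF.
Qed.

Let q_gt0 x : (0 < q x)%R.
Proof. by apply: exit_rate_gt0 => //; exact: two_states. Qed.

Let J0 x y : 0 <= J x y.
Proof. exact: jump_ge0. Qed.

(* The states of level at most [- (n + 1)]. *)
Definition below (n : nat) : set (state l) := [set y | (n < y.1)%N].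

(** The first component is a depth, so [up n] lowers the level by [n]. *)
Let up (n : nat) (x : state l) : state l := ((x.1 + n)%N, x.2).

(** Homogeneity of the rates. Depth 0 is excluded at both ends, since [W'] and [U'] replace [W] and
    [U] there. *)
Lemma qsf_shift n (x y : state l) : (0 < x.1)%N -> (0 < y.1)%N ->
  Q (up n x) (up n y) = Q x y.
Proof.
case: x y => [a i] [b j] /= a0 b0; rewrite /Q /= -addSn !eqn_add2r ltn_add2r.
by rewrite subnDr !addn_eq0 !(gtn_eqF a0) !(gtn_eqF b0).
Qed.

Lemma up_eq n x y : (up n x == up n y) = (x == y).
Proof. by case: x y => [a i] [b j]; rewrite !xpair_eqE eqn_add2r. Qed.

Lemma exit_rate_shift n x : (0 < x.1)%N -> q (up n x) = q x.
Proof. by move=> x0; rewrite /exit_rate qsf_shift. Qed.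

Lemma jump_shift n x y : (0 < x.1)%N -> (0 < y.1)%N -> J (up n x) (up n y) = J x y.
Proof.
by move=> x0 y0; rewrite /jump /jump_prob up_eq qsf_shift// exit_rate_shift.
Qed.

(** Term by term, by induction on the number of jumps. The iterates vanish at depths up to [n], so
    the sum over the sources can be shifted by [n] as well. *)
Lemma green_shift n i x : (0 < x.1)%N ->
  green (krestr (below n) J) (mdirac (n.+1, i)) (up n x) =
  green (krestr (below 0) J) (mdirac (1%N, i)) x.
Proof.
move=> x0; apply: eq_eseriesr => m _.
have k0 k a b : 0 <= krestr (below k) J a b by exact: krestr_ge0.
have nu0 k m' a : 0 <= iter m' (step (krestr (below k) J)) (mdirac (k.+1, i)) a.
  by apply: iter_step_ge0 => // ?; exact: mdirac_ge0.
have nuN k m' a b : (a <= k)%N ->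
    iter m' (step (krestr (below k) J)) (mdirac (k.+1, i)) (a, b) = 0.
  move=> ak; case: m' => [|m'] /=.
    by rewrite /mdirac xpair_eqE ltn_eqF// ltnS.
  by rewrite step_krestr_out// notin_setE /below /= ltnNge ak.
elim: m x x0 => [|m IH] x x0.
  rewrite /= /mdirac (_ : (n.+1, i) = up n (1%N, i)); last by rewrite /up/= add1n.
  by rewrite up_eq.
rewrite /= step_krestr_in; last first.
  by rewrite inE /below/= -[ltnLHS]add0n ltn_add2r.
rewrite step_krestr_in; last by rewrite inE.
rewrite /step (@esum_shift _ _ _ n); last 2 first.
- by move=> a b an; rewrite nuN ?mul0e// ltnW.
- move=> a; apply: mule_ge0; [exact: nu0|exact: J0].
apply: eq_esum => -[[|a] b] _.
  by rewrite /= add0n !nuN ?mul0e.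
by rewrite (IH (a.+1, b))// (jump_shift n (x := (a.+1, b))).
Qed.

(** This is [T] for [m = 0]: the mean number of visits times the mean sojourn time. Here, in
    [level_t_hat] and in [level_gamma], sums are unordered, which suits nonnegative [c] and [r]. *)
Definition level_green (k j : phase l) : \bar R :=
  green (krestr (below 0) J) (mdirac (1%N, k)) (1%N, j) * ((q (1%N, j))^-1)%:E.

Definition level_t_hat (j : phase l) : \bar R :=
  \esum_(k in [set: phase l]) ((r k)%:E * level_green k j).

Definition level_gamma : \bar R :=
  \esum_(i in [set: phase l]) ((c i)%:E * level_t_hat i).

Let qV0 x : 0 <= ((q x)^-1)%:E.
Proof. by rewrite lee_fin invr_ge0 ltW. Qed.

Let cE0 i : 0 <= (c i)%:E. Proof. by rewrite lee_fin. Qed.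
Let rE0 i : 0 <= (r i)%:E. Proof. by rewrite lee_fin. Qed.

Lemma level_green_ge0 k j : 0 <= level_green k j.
Proof.
rewrite mule_ge0//; apply: green_ge0 => [*|?]; last exact: mdirac_ge0.
exact: krestr_ge0.
Qed.

Lemma level_t_hat_ge0 j : 0 <= level_t_hat j.
Proof. by apply: esum_ge0 => k _; rewrite mule_ge0// level_green_ge0. Qed.

Lemma level_gamma_ge0 : 0 <= level_gamma.
Proof. by apply: esum_ge0 => k _; rewrite mule_ge0// level_t_hat_ge0. Qed.

Section FedLevels.
Variable mu : state l -> \bar R.
Hypothesis mu0 : forall x, 0 <= mu x.
Hypothesis fed : forall n, fed_from_outside Q mu (below n).

Let pi x := mu x * ((q x)^-1)%:E.
Let pi0 x : 0 <= pi x. Proof. exact: mule_ge0. Qed.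

Definition down_rate n : \bar R :=
  \esum_(i in [set: phase l]) (mu (n, i) * ((q (n, i))^-1)%:E * (c i)%:E).

Lemma down_rate_ge0 n : 0 <= down_rate n.
Proof. by apply: esum_ge0 => i _; rewrite !mule_ge0. Qed.

(* Level [- (n + 1)] is entered from above only from level [- n], and then in
   phase [k] at a rate proportional to [r k]. *)
Lemma step_below n z :
  step (krestr (below n) J) (mrestr (~` (below n)) mu) z =
  if z.1 == n.+1 then down_rate n * (r z.2)%:E else 0.
Proof.
have [zn|nz] := leqP z.1 n.
  rewrite step_krestr_out; last by rewrite notin_setE /below /= ltnNge zn.
  by rewrite ltn_eqF.
rewrite step_krestr_in; last by rewrite inE.
transitivity (\esum_(x in [set: state l]) (if x.1 == n then
    (if z.1 == n.+1 then pi (n, x.2) * (c x.2)%:E * (r z.2)%:E else 0) else 0)).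
  apply: eq_esum => -[b i] _; rewrite /mrestr in_setC.
  case: z nz => m k /= nm.
  have [nb|bn] := boolP ((b, i) \in below n).
    by move: nb; rewrite inE /below/= => nb; rewrite gtn_eqF// mul0e.
  move: bn; rewrite notin_setE /below/= => /negP; rewrite -leqNgt => bn.
  have bm : (b < m)%N by exact: leq_ltn_trans bn nm.
  rewrite /jump /jump_prob xpair_eqE ltn_eqF//= /Q /=.
  rewrite (gtn_eqF bm) (gtn_eqF (leq_ltn_trans (leq0n b) bm)) ltnNge (ltnW bm) /=.
  have [E|bn'] := eqVneq b n; last first.
    have -> : (m == b.+1) = false by rewrite gtn_eqF// (leq_trans _ nm)// ltnS ltn_neqAle bn'.
    by rewrite mul0r mule0.
  rewrite E; case: eqP => _; last by rewrite mul0r mule0.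
  by rewrite DE /pi -!muleA -!EFinM; congr (_ * _%:E); rewrite mulrC.
rewrite (@esum_fiber _ _ _ (fun i =>
  if z.1 == n.+1 then pi (n, i) * (c i)%:E * (r z.2)%:E else 0)); last first.
  by move=> i; case: ifP => // _; rewrite !mule_ge0.
case: eqP => _; last exact: esum1.
by rewrite esumZr// => i; rewrite mule_ge0.
Qed.

(** Expand the fed equation over the entrance states: by [step_below] these are the [(n.+1, k)],
    with mass [down_rate n * r k], and [green_shift] brings each Green function back to depth 1. *)
Lemma fed_level n j : pi (n.+1, j) = down_rate n * level_t_hat j.
Proof.
have k0 a b : 0 <= krestr (below n) J a b by exact: krestr_ge0.
have g0 a b : 0 <= green (krestr (below n) J) (mdirac a) b.
  by apply: green_ge0 => // ?; exact: mdirac_ge0.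
have d0 := down_rate_ge0 n.
rewrite /pi (@fed n (n.+1, j) (ltnSn n)) (green_dirac k0); last first.
  move=> x; apply: step_ge0 => // y; exact: mrestr_ge0.
transitivity ((\esum_(x in [set: state l]) (if x.1 == n.+1 then
    down_rate n * (r x.2)%:E * green (krestr (below n) J) (mdirac (n.+1, x.2)) (n.+1, j)
    else 0)) * ((q (n.+1, j))^-1)%:E).
  congr (_ * _); apply: eq_esum => -[b i] _; rewrite step_below/=.
  by case: eqP => [->//|_]; rewrite mul0e.
rewrite (@esum_fiber _ _ _ (fun k => down_rate n * (r k)%:E *
  green (krestr (below n) J) (mdirac (n.+1, k)) (n.+1, j))); last first.
  by move=> k; rewrite !mule_ge0.
rewrite -esumZr//; last by move=> k; rewrite !mule_ge0.
rewrite /level_t_hat -esumZl//; last by move=> k; rewrite mule_ge0// level_green_ge0.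
apply: eq_esum => k _; rewrite /level_green -!muleA.
by rewrite -(green_shift n k (x := (1%N, j)))// -(exit_rate_shift n (x := (1%N, j))).
Qed.

Lemma fed_level_formula n j :
  pi (n.+1, j) = down_rate 0 * level_gamma ^+ n * level_t_hat j.
Proof.
suff d n' : down_rate n' = down_rate 0 * level_gamma ^+ n' by rewrite fed_level d.
elim: n' => [|n' IH]; first by rewrite expe0 mule1.
have d0 := down_rate_ge0 n'.
rewrite expeS (muleC level_gamma) muleA -IH.
rewrite /level_gamma -esumZl//; last by move=> i; rewrite mule_ge0// level_t_hat_ge0.
apply: eq_esum => i _; rewrite -/(pi (n'.+1, i)) fed_level -muleA.
by rewrite (muleC (level_t_hat i)).
Qed.

End FedLevels.

End Levels.

(** The depth increases only through [D]. If [D] had no positive entry, no path could lead from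
    depth 0 to depth 1, against irreducibility. *)
Lemma down_transition (R : realType) (l : option nat)
    (D W W' : phase l -> phase l -> R) (U U' : nat -> phase l -> phase l -> R) :
  irreducible (qsf_matrix D W U W' U') -> exists i j, 0 < D i j.
Proof.
move=> irrQ; have ph0 : phase l by exists 0%N; case: (l).
apply: contrapT => nD.
have [p [pth lst]] := irrQ (0%N, ph0) (1%N, ph0).
suff le a s : path (fun a b => (a != b) && (0 < qsf_matrix D W U W' U' a b)) a s ->
    ((last a s).1 <= a.1)%N by have := le _ _ pth; rewrite lst.
elim: s a => [|b s IH] a //= /andP[/andP[_ Qab] pth'].
apply: leq_trans (IH b pth') _; case: a b Qab {IH pth'} => [a i] [b j] /=.
case: (leqP b a) => // ab; rewrite /qsf_matrix.
case: eqP => [_ Dij|_]; first by case: nD; exists i, j.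
by rewrite (gtn_eqF ab) (gtn_eqF (leq_ltn_trans (leq0n a) ab)) ltnNge (ltnW ab)/= ltxx.
Qed.

(** * The three claims when [c] and [r] are nonnegative *)

Section NonnegativeFactors.
Context {R : realType} {l : option nat} {d : measure_display}
  {Omega : measurableType d}.
Variables (D W W' : phase l -> phase l -> R) (U U' : nat -> phase l -> phase l -> R).
Variables (P : state l -> probability Omega R).
Variables (Y : nat -> Omega -> state l) (H : nat -> Omega -> R).
Variables (c r : phase l -> R) (n0 : nat).
Let Q := qsf_matrix D W U W' U'.
Hypothesis scQ : stable_conservative Q.
Hypothesis irrQ : irreducible Q.
Hypothesis mp : minimal_process P Y H Q.
Hypothesis DE : forall i j, D i j = c i * r j.
Hypothesis c0 : forall i, 0 <= c i.
Hypothesis r0 : forall j, 0 <= r j.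
Notation q := (exit_rate Q).
Notation J := (jump Q).
Local Open Scope ereal_scope.

Notation that := (level_t_hat D W W' U U' r).
Notation gamma := (level_gamma D W W' U U' c r).
Notation lgreen := (level_green D W W' U U').

Let S2 := @two_states l.
Let q_gt0 := exit_rate_gt0 scQ irrQ S2.
Let J0 x y : 0 <= J x y. Proof. exact: jump_ge0. Qed.
Let qV0 x : 0 <= ((q x)^-1)%:E.
Proof. by rewrite lee_fin invr_ge0 ltW. Qed.
Let cE0 i : 0 <= (c i)%:E. Proof. by rewrite lee_fin. Qed.
Let rE0 i : 0 <= (r i)%:E. Proof. by rewrite lee_fin. Qed.
Let that0 j : 0 <= that j. Proof. exact: level_t_hat_ge0. Qed.
Let gamma0 : 0 <= gamma. Proof. exact: level_gamma_ge0. Qed.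

Lemma T_matrixE k j : T_matrix P Y H n0 k j = lgreen k j.
Proof.
rewrite /T_matrix (expected_time_beforeE scQ q_gt0 mp) /=; [|by rewrite ltnn..].
rewrite (_ : ~` _ = below n0); last first.
  by apply/seteqP; split => y /=; rewrite /below/= ltnNge => /negP.
rewrite /level_green -(green_shift scQ irrQ n0 k (x := (1%N, j)))//.
by rewrite -(exit_rate_shift D W W' U U' n0 (x := (1%N, j))).
Qed.

Lemma t_hatE j : t_hat (T_matrix P Y H n0) r j = that j.
Proof.
rewrite /t_hat phase_sumE => [|k].
  by apply: eq_esum => k _; rewrite T_matrixE.
by rewrite T_matrixE mule_ge0// level_green_ge0.
Qed.

Lemma gamma_ofE : gamma_of (T_matrix P Y H n0) c r = gamma.
Proof.
rewrite /gamma_of phase_sumE => [|k].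
  by apply: eq_esum => k _; rewrite t_hatE.
by rewrite t_hatE mule_ge0.
Qed.

Lemma stationary_level_formula p n j : stationary_distribution P Y H p ->
  (p (n.+1, j))%:E = gamma ^+ n *
    phase_sum (fun i => (p (0%N, i))%:E * (c i)%:E * that j).
Proof.
move=> stp; have [p0 _ _] := stp.
pose mu x := (p x * q x)%:E.
have muq x : mu x * ((q x)^-1)%:E = (p x)%:E.
  by rewrite -EFinM mulfK// gt_eqF.
have mu0 x : 0 <= mu x by rewrite lee_fin mulr_ge0// ltW.
have fed m : fed_from_outside Q mu (below m).
  by apply: (stationary_fed scQ irrQ S2 mp stp (z := (0%N, j))).
rewrite -muq (fed_level_formula DE c0 r0 scQ irrQ mu0 fed) -muleA muleCA.
congr (_ * _); rewrite phase_sumE => [|i]; last by rewrite !mule_ge0// lee_fin.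
rewrite esumZr// => [|i]; last by rewrite mule_ge0// lee_fin.
by congr (_ * _); apply: eq_esum => i _; rewrite muq.
Qed.

Lemma level_green_lty k j : lgreen k j < +oo.
Proof.
have [||C hC] := @green_bounded _ _ _ scQ irrQ S2 (below 0) (0%N, j) (1%N, j) => //.
apply: lte_mul_pinfty; rewrite ?ltry//.
  by apply: green_ge0 => [*|?]; [exact: krestr_ge0|exact: mdirac_ge0].
rewrite ge0_fin_numE ?(le_lt_trans (hC _)) ?ltry//.
by apply: green_ge0 => [*|?]; [exact: krestr_ge0|exact: mdirac_ge0].
Qed.

Lemma that_lty j : l <> None -> that j < +oo.
Proof.
move=> lN; apply: esum_phase_lty => // k; first by rewrite mule_ge0// level_green_ge0.
by rewrite lte_mul_pinfty// level_green_lty.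
Qed.

Section DownPhase.
Variables i0 j0 : phase l.
Hypotheses (ci0 : (0 < c i0)%R) (rj0 : (0 < r j0)%R).
Let x0 : state l := (0%N, i0).
Let mu := green (krestr (~` [set x0]) J) (mdirac x0).

Let mu0 x : 0 <= mu x. Proof. exact: excursion_ge0. Qed.

Let fed n : fed_from_outside Q mu (below n).
Proof. exact: (excursion_fed scQ irrQ S2). Qed.

Let formula n j := fed_level_formula DE c0 r0 scQ irrQ mu0 fed n j.

(** The occupation of an excursion from [(0, i0)] has mass at most the mean return time. If
    [gamma >= 1], phase [j0] receives at every level below 0 at least the mass
    [down_rate 0 * that j0], positive by the choice of [i0] and [j0], and the total is infinite. *)
Lemma recurrent_gamma_lt1 : positive_recurrent P Y H -> gamma < 1.
Proof.
move=> /(_ x0) /(le_lt_trans (le_return_time scQ q_gt0 mp x0)) fin.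
rewrite ltNge; apply/negP => gamma1.
have : \esum_(y in [set: state l]) (mu y * ((q y)^-1)%:E) = +oo; last first.
  by move: fin => /[swap]; rewrite /mu => ->.
have a0 : 0 < down_rate D W W' U U' c mu 0.
  apply: lt_le_trans (esum_ge1 i0 _).
    by rewrite /mu excursion_start// mul1e -EFinM lte_fin mulr_gt0// invr_gt0.
  by move=> i; rewrite !mule_ge0.
have t0 : 0 < that j0.
  apply: lt_le_trans (esum_ge1 j0 _); last first.
    by move=> k; rewrite mule_ge0// level_green_ge0.
  rewrite mule_gt0 ?lte_fin// /level_green mule_gt0 ?lte_fin ?invr_gt0//.
  apply: (@lt_le_trans _ _ 1); first exact: lte01.
  by apply: green_dirac_ge1 => *; exact: krestr_ge0.
rewrite esum_pair; last by move=> x; rewrite mule_ge0.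
rewrite -nneseries_esumT; last by move=> n; apply: esum_ge0 => *; rewrite mule_ge0.
rewrite nneseries_recl1; last by move=> n; apply: esum_ge0 => *; rewrite mule_ge0.
rewrite [X in _ + X](@nneseries_cst_pinfty _ _ (down_rate D W W' U U' c mu 0 * that j0)).
- by rewrite addey// gt_eqF// (lt_le_trans (ltNyr 0))// esum_ge0// => *; rewrite mule_ge0.
- by move=> n; apply: esum_ge0 => *; rewrite mule_ge0.
- by rewrite mule_gt0.
- move=> n; apply: le_trans (esum_ge1 j0 _); last by move=> *; rewrite mule_ge0.
  rewrite formula; apply: lee_wpmul2r => //; rewrite -[leLHS]mule1.
  apply: lee_wpmul2l; first exact: ltW.
  elim: n => [|n IH]; first by rewrite expe0.
  by rewrite expeS -[leLHS]mule1; apply: lee_pmul.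
Qed.

Lemma gamma_lt1_recurrent : gamma < 1 -> l <> None -> nonexplosive P H ->
  positive_recurrent P Y H.
Proof.
move=> gamma1 lN ne x; rewrite (return_time_eq scQ q_gt0 mp)//.
have multy y : mu y < +oo by exact: excursion_lty.
have M : \esum_(y in [set: state l]) (mu y * ((q y)^-1)%:E) < +oo.
  rewrite esum_pair; last by move=> y; rewrite mule_ge0.
  rewrite -nneseries_esumT; last by move=> n; apply: esum_ge0 => *; rewrite mule_ge0.
  rewrite nneseries_recl1; last by move=> n; apply: esum_ge0 => *; rewrite mule_ge0.
  have qVy y : ((q y)^-1)%:E < +oo by exact: ltry.
  have muqy y : mu y * ((q y)^-1)%:E < +oo by rewrite lte_mul_pinfty// ge0_fin_numE.
  have a0 : 0 <= down_rate D W W' U U' c mu 0 by exact: down_rate_ge0.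
  have ay : down_rate D W W' U U' c mu 0 < +oo.
    apply: esum_phase_lty => // i; first by rewrite !mule_ge0.
    by rewrite lte_mul_pinfty ?ltry ?mule_ge0// ge0_fin_numE// mule_ge0.
  rewrite lte_add_pinfty//.
    by apply: esum_phase_lty => // i; rewrite mule_ge0.
  (* The levels below 0 contribute a geometric series of ratio [gamma]; its coefficient is finite
     because there are finitely many phases. *)
  rewrite (eq_eseriesr (g := fun n => down_rate D W W' U U' c mu 0 *
    (\esum_(j in [set: phase l]) that j) * gamma ^+ n)); last first.
    move=> n _; rewrite muleAC -esumZl//; last by rewrite mule_ge0// expe_ge0.
    by apply: eq_esum => j _; rewrite formula.
  have th0 : 0 <= \esum_(j in [set: phase l]) that j by exact: esum_ge0.
  rewrite nneseriesZl_ge0; last 2 first.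
  - exact: mule_ge0.
  - by move=> n; exact: expe_ge0.
  have thy : \esum_(j in [set: phase l]) that j < +oo.
    by apply: esum_phase_lty => // j; exact: that_lty.
  rewrite lte_mul_pinfty ?geometric_lty ?mule_ge0// ge0_fin_numE ?mule_ge0//.
  by rewrite lte_mul_pinfty// ge0_fin_numE.
(* Finiteness passes from the excursions of [x0] to those of [x] by [excursion_min], as [mu x] is
   positive. *)
have mux : 0 < mu x by exact: excursion_gt0.
have g0 y : 0 <= green (krestr (~` [set x]) J) (mdirac x) y.
  by apply: green_ge0 => [*|?]; [exact: krestr_ge0|exact: mdirac_ge0].
apply: (esumZl_lty mux) => [y|]; first by rewrite mule_ge0.
apply: le_lt_trans M; apply: le_esum => y _; rewrite muleA.
by apply: lee_wpmul2r => //; exact: excursion_min.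
Qed.

End DownPhase.

End NonnegativeFactors.

Lemma t_hatN (R : realType) (l : option nat) (T : phase l -> phase l -> \bar R)
    (r : phase l -> R) j : (forall k i, 0 <= T k i)%E -> (forall k, r k <= 0) ->
  t_hat T r j = (- t_hat T (fun k => - r k)%R j)%E.
Proof.
move=> T0 r0; rewrite /t_hat -phase_sumN => [|k]; last first.
  by rewrite mule_ge0// lee_fin oppr_ge0.
by congr phase_sum; apply/funext => k; rewrite EFinN mulNe oppeK.
Qed.

Theorem theorem2p3 (R : realType) (l : option nat)
  (D W W' : phase l -> phase l -> R)
  (U U' : nat -> phase l -> phase l -> R)
  (d : measure_display) (Omega : measurableType d)
  (P : state l -> probability Omega R)
  (Y : nat -> Omega -> state l) (H : nat -> Omega -> R)
  (c r : phase l -> R) (n0 : nat) :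
  let Q := qsf_matrix D W U W' U' in
  let T := T_matrix P Y H n0 in
  let that := t_hat T r in
  let gamma := gamma_of T c r in
  stable_conservative Q ->
  irreducible Q ->
  minimal_process P Y H Q ->
  nonexplosive P H ->
  (forall i j, D i j = c i * r j) ->
  [/\ (gamma < 1)%E /\ l <> None -> positive_recurrent P Y H,
      positive_recurrent P Y H -> (gamma < 1)%E
    & ((gamma < 1)%E /\ l <> None) \/ positive_recurrent P Y H ->
      forall p : state l -> R, stationary_distribution P Y H p ->
      (* level m = - n.+1, so that - (m + 1) = n *)
      forall (n : nat) (j : phase l),
        (p (n.+1, j))%:E =
        (gamma ^+ n *
          phase_sum (fun i => (p (0%N, i))%:E * (c i)%:E * that j))%E].
Proof.
move=> Q T that gamma scQ irrQ mp ne DE.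
have [i0 [j0 D0]] := down_transition irrQ.
(* The sign of [c' i0] settles all the others: as [D] is nonnegative, every [r' j] is nonnegative;
   as [D i0 j0 > 0], [r' j0] is positive, and then every [c' i] is nonnegative. *)
have nonneg (c' r' : phase l -> R) : (forall i j, D i j = c' i * r' j) -> 0 < c' i0 ->
  [/\ (gamma_of T c' r' < 1)%E /\ l <> None -> positive_recurrent P Y H,
      positive_recurrent P Y H -> (gamma_of T c' r' < 1)%E
    & forall p : state l -> R, stationary_distribution P Y H p -> forall n j,
        (p (n.+1, j))%:E = (gamma_of T c' r' ^+ n *
          phase_sum (fun i => (p (0%N, i))%:E * (c' i)%:E * t_hat T r' j))%E].
  move=> DE' ci0.
  have Dge0 i j : 0 <= D i j by have [/(_ (0%N, i) (1%N, j) isT)] := scQ.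
  have r0 j : 0 <= r' j by have := Dge0 i0 j; rewrite DE' pmulr_rge0.
  have rj0 : 0 < r' j0 by move: D0; rewrite DE' pmulr_rgt0.
  have c0 i : 0 <= c' i by have := Dge0 i j0; rewrite DE' pmulr_lge0.
  rewrite (gamma_ofE n0 scQ irrQ mp c0 r0).
  split => [[g1 lN]|pr|p stp n j].
  - exact: (gamma_lt1_recurrent scQ irrQ mp DE' c0 r0 i0 g1 lN ne).
  - exact: (recurrent_gamma_lt1 scQ irrQ mp DE' c0 r0 ci0 rj0 pr).
  - rewrite (stationary_level_formula scQ irrQ mp DE' c0 r0 n j stp).
    by rewrite (t_hatE n0 scQ irrQ mp r0).
have T0 k j : (0 <= T k j)%E by apply: integral_ge0.
have [ci0|ci0] := ltP 0 (c i0).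
  by have [h1 h2 h3] := nonneg c r DE ci0; split => // _ p stp n j; exact: h3.
(* Otherwise [c i0] is negative, being nonzero since [D i0 j0 > 0], and the factorization of [D] by
   [- c] and [- r] is used instead. *)
have {}ci0 : 0 < - c i0.
  rewrite oppr_gt0 lt_neqAle ci0 andbT; apply: contraTneq D0 => c0.
  by rewrite DE c0 mul0r ltxx.
have r0 j : r j <= 0.
  have [/(_ (0%N, i0) (1%N, j) isT)] := scQ.
  by rewrite /Q /= DE -mulrNN pmulr_rge0// oppr_ge0.
have [i j|h1 h2 h3] := nonneg (fun i => - c i) (fun j => - r j) _ ci0.
  by rewrite DE mulrNN.
(* The vector [that] changes sign together with [r]. Both [gamma] and the products of [c i] with
   [that j] undergo two sign changes and are preserved. *)
have tN j : that j = (- t_hat T (fun k => - r k)%R j)%E by exact: t_hatN.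
have gE : gamma = gamma_of T (fun i => - c i) (fun j => - r j).
  rewrite /gamma /gamma_of; congr phase_sum; apply/funext => i.
  by rewrite -/(that i) tN EFinN mulNe muleN.
rewrite gE; split; [exact: h1|exact: h2|].
move=> _ p stp n j.
rewrite (h3 p stp n j).
apply: (congr1 (mule _)).
apply: (congr1 phase_sum); apply/funext => i.
by rewrite tN EFinN !muleN mulNe.
Qed.
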